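(* Let $0<\alpha<2$ and let $X=\{X(t):t\in\mathbb{R}\}$ be a stationary real harmonizable symmetric $\alpha$-stable process with finite control measure $m$, where $m$ is absolutely continuous with respect to Lebesgue measure on $\mathbb{R}$, with symmetric density $f$ and $m(\mathbb{R})=1$. Then, for all $\lambda\in\mathbb{R}$, $$T^{-1}\int_0^Te^{i\lambda X(\tau)}d\tau\longrightarrow\mathbb{E}\left[e^{i\lambda X(t)}\,\middle|\,\mathcal{A}\right]=\prod_{k=1}^\infty J_0(\lambda R_k)\quad\text{almost surely}$$ as $T\to\infty$, where $\mathcal{A}=\sigma\left(\{\Gamma_k^{-1/\alpha}G_k^{(1)},\Gamma_k^{-1/\alpha}G_k^{(2)},Z_k\}_{k\in\mathbb{N}}\right)$, the quantities $\Gamma_k,G_k^{(1)},G_k^{(2)},Z_k,R_k$ are those of the series representations of $X$ given in the context, and $J_0(s)=\frac{1}{2\pi}\int_{-\pi}^{\pi}e^{is\cos(u)}du$ is the Bessel function of the first kind of order $0$.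
   Context: Stationary real harmonizable symmetric $\alpha$-stable (SRH $S\alpha S$) process: $X(t)=\mathrm{Re}\left(\int_{\mathbb{R}}e^{itx}M(dx)\right)$, $t\in\mathbb{R}$, where $M$ is an isotropic complex $S\alpha S$ random measure on $\mathbb{R}$ with finite control measure $m$. That is, $M$ is an independently scattered, $\sigma$-additive, complex-valued random set function such that for every Borel set $A$ the vector $(\mathrm{Re}\,M(A),\mathrm{Im}\,M(A))$ is jointly symmetric $\alpha$-stable with characteristic function $s\mapsto\exp\{-m(A)\int_{S^1}|(\theta,s)|^\alpha\gamma(d\theta)\}$, where $\gamma$ is the uniform probability measure on the unit circle $S^1$. LePage series representation: $X$ is conditionally stationary centered Gaussian with $$X(t)\stackrel{d}{=}\left(C_\alpha b_\alpha^{-1}m(\mathbb{R})\right)^{1/\alpha}\sum_{k=1}^\infty\Gamma_k^{-1/\alpha}\left(G_k^{(1)}\cos(tZ_k)+G_k^{(2)}\sin(tZ_k)\right),\quad t\in\mathbb{R},$$ where $\{\Gamma_k\}_{k\ge1}$ denotes the arrival times of a unit rate Poisson process, $\{G_k^{(i)}\}_{k\ge1}$, $i=1,2$, are sequences of i.i.d. standard normally distributed random variables, $\{Z_k\}_{k\ge1}$ is a sequence of i.i.d. random variables with law $m(\cdot)/m(\mathbb{R})$ (so with density $f$), $b_\alpha=2^{\alpha/2}\Gamma(1+\alpha/2)$ (here $\Gamma(\cdot)$ is the gamma function), and $C_\alpha=\left(\int_0^\infty x^{-\alpha}\sin(x)dx\right)^{-1}$. Amplitude-phase-frequency representation: with the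 same sequences, $$X(t)\stackrel{d}{=}\sum_{k=1}^\infty R_k\cos(\Theta_k+tZ_k),\qquad R_k=\left(C_\alpha b_\alpha^{-1}m(\mathbb{R})\right)^{1/\alpha}\Gamma_k^{-1/\alpha}\sqrt{\left(G_k^{(1)}\right)^2+\left(G_k^{(2)}\right)^2},$$ where $\{\Theta_k\}_{k\ge1}$ are i.i.d. uniformly distributed on $(0,2\pi)$, obtained as the phases of the complex coefficients $A_k=\frac12\left(C_\alpha b_\alpha^{-1}m(\mathbb{R})\right)^{1/\alpha}\Gamma_k^{-1/\alpha}\left(G_k^{(1)}-iG_k^{(2)}\right)$, for which $R_k=2|A_k|$.
   Formalization: The identity E[e^{iλX(t)}|𝒜]=∏J₀(λR_k) is proved assuming the phases Θ_k are independent of 𝒜; with Θ_k the phases of A_k, X(t) is 𝒜-measurable and it fails. The series representation is taken to hold a.s. on the space of X, with X jointly measurable. The time-average limit needs no such independence. *)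

(* Defs.v *)
From HB Require Import structures.
From mathcomp Require Import all_boot all_order all_algebra.
From mathcomp Require Import all_classical all_reals all_analysis.
From mathcomp Require Import complex.

Set Implicit Arguments.
Unset Strict Implicit.
Unset Printing Implicit Defensive.
Import Order.TTheory GRing.Theory Num.Theory.
Import numFieldNormedType.Exports.
Local Open Scope classical_set_scope.
Local Open Scope ring_scope.
Local Open Scope complex_scope.

Definition expi (R : realType) (x : R) : R[i] := cos x +i* sin x.

Definition cintegral d (T : measurableType d) (R : realType)
    (mu : {measure set T -> \bar R}) (D : set T) (f : T -> R[i]) : R[i] :=
  Rintegral mu D (fun x => complex.Re (f x))
    +i* Rintegral mu D (fun x => complex.Im (f x)).

Definition cintegrable d (T : measurableType d) (R : realType)
    (mu : {measure set T -> \bar R}) (D : set T) (f : T -> R[i]) : Prop :=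
  mu.-integrable D (fun x => (complex.Re (f x))%:E) /\
  mu.-integrable D (fun x => (complex.Im (f x))%:E).

Definition besselJ0 (R : realType) (s : R) : R[i] :=
  ((2 * pi)^-1)%:C *
  cintegral lebesgue_measure `[- pi, pi] (fun u : R => expi (s * cos u)).

Definition Gamma_fun (R : realType) (s : R) : R :=
  Rintegral lebesgue_measure `]0, +oo[ (fun x : R => x `^ (s - 1) * expR (- x)).

Lemma twopi_gt0 (R : realType) : 0 < 2 * pi :> R.
Proof. by rewrite mulr_gt0 ?pi_gt0. Qed.

Definition sigma_gen d (T : measurableType d) (R : realType) (I : Type)
    (X : I -> T -> R) : set_system T :=
  <<s \bigcup_i preimage_set_system [set: T] (X i) measurable >>.

Definition independent_systems d (T : measurableType d) (R : realType)
    (P : probability T R) (I : choiceType) (F : I -> set_system T) : Prop :=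
  forall (s : seq I) (A : I -> set T), uniq s ->
    (forall i, i \in s -> F i (A i)) ->
    P (\bigcap_(i in [set` s]) A i) = (\prod_(i <- s) P (A i))%E.

Definition independent2 d (T : measurableType d) (R : realType)
    (P : probability T R) (F G : set_system T) : Prop :=
  forall A B, F A -> G B -> P (A `&` B) = (P A * P B)%E.

Definition independent_RVs d (T : measurableType d) (R : realType)
    (P : probability T R) (I : choiceType) (X : I -> T -> R) : Prop :=
  independent_systems P
    (fun i => preimage_set_system [set: T] (X i) measurable).

Definition has_law d (T : measurableType d) (R : realType)
    (P : probability T R) (X : {RV P >-> R}) (mu : set R -> \bar R) : Prop :=
  forall B : set R, measurable B -> distribution P X B = mu B.

(* [W] is a version of E[Y | F]; [F] is meant to be a sub-sigma-algebra. *)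
Definition is_cond_expectation d (T : measurableType d) (R : realType)
    (P : probability T R) (F : set_system T) (Y W : T -> R[i]) : Prop :=
  [/\ cintegrable P [set: T] Y,
      cintegrable P [set: T] W,
      (forall B : set R, measurable B ->
         F ((fun w => complex.Re (W w)) @^-1` B) /\
         F ((fun w => complex.Im (W w)) @^-1` B)) &
      forall A, F A -> cintegral P A W = cintegral P A Y].

Section stable_measure.
Context d (T : measurableType d) (R : realType) (P : probability T R).
Variables (m : {finite_measure set (measurableTypeR R) -> \bar R}) (alpha : R).

(* The uniform probability on the unit circle is the image of the uniform law
   on (0, 2 pi) under phi |-> (cos phi, sin phi). *)
Definition circle_norm (s1 s2 : R) : R :=
  Rintegral (uniform_prob (twopi_gt0 R)) [set: R]
    (fun phi : R => `|cos phi * s1 + sin phi * s2| `^ alpha).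

(* Independent scattering and sigma-additivity are stated for sequences of
   disjoint sets; finite families are padded with empty sets. *)
Definition isotropic_SaS_measure (M : set R -> T -> R[i]) : Prop :=
  [/\ (forall A : set R, measurable A ->
         measurable_fun [set: T] (fun w => complex.Re (M A w)) /\
         measurable_fun [set: T] (fun w => complex.Im (M A w))),
      (forall A : nat -> set R, (forall n, measurable (A n)) ->
         trivIset [set: nat] A ->
         independent_systems P (fun n => sigma_gen (fun b : bool =>
           fun w => if b then complex.Re (M (A n) w)
                    else complex.Im (M (A n) w)))),
      (forall A : nat -> set R, (forall n, measurable (A n)) ->
         trivIset [set: nat] A ->
         {ae P, forall w, (fun n => \sum_(k < n) M (A k) w) @ \oo -->
                          (M (\bigcup_n A n) w : R[i]^o)}) &
      (forall A : set R, measurable A -> forall s1 s2 : R,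
         cintegral P [set: T] (fun w =>
           expi (s1 * complex.Re (M A w) + s2 * complex.Im (M A w)))
         = (expR (- (fine (m A) * circle_norm s1 s2)))%:C)].

(* A list of pairs (c, A) encodes the simple function sum of c 1_A. *)
Definition simple_value (h : seq (R[i] * set R)) (x : R) : R[i] :=
  \sum_(p <- h) p.1 * (\1_(p.2) x)%:C.

Definition simple_integral (M : set R -> T -> R[i]) (h : seq (R[i] * set R))
    (w : T) : R[i] :=
  \sum_(p <- h) p.1 * M p.2 w.

Definition cvg_in_probability (Y : nat -> T -> R[i]) (Y0 : T -> R[i]) : Prop :=
  forall e : R, 0 < e ->
    P [set w | e <= Normc.normc (Y n w - Y0 w)] @[n --> \oo] --> 0%E.

(* [J] is (a version of) the integral of [g] with respect to [M]: the limit in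
   probability of integrals of simple functions tending to [g] in L^alpha(m). *)
Definition is_stochastic_integral (M : set R -> T -> R[i]) (g : R -> R[i])
    (J : T -> R[i]) : Prop :=
  [/\ measurable_fun [set: T] (fun w => complex.Re (J w)),
      measurable_fun [set: T] (fun w => complex.Im (J w)) &
      exists h : nat -> seq (R[i] * set R),
      [/\ (forall n p, p \in h n -> measurable p.2),
          (\int[m]_x ((Normc.normc (simple_value (h n) x - g x)) `^ alpha)%:E)%E
            @[n --> \oo] --> 0%E &
          cvg_in_probability (fun n => simple_integral M (h n)) J]].

(* Stationarity is automatic, since [M] is isotropic. *)
Definition stationary_SRH_SaS (X : R -> T -> R) : Prop :=
  exists2 M, isotropic_SaS_measure M &
    forall t : R, exists2 J,
      is_stochastic_integral M (fun x => expi (t * x)) J &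
      {ae P, forall w, X t w = complex.Re (J w)}.

End stable_measure.

Section series_representation.
Context d (T : measurableType d) (R : realType) (P : probability T R).
Variables (m : {finite_measure set (measurableTypeR R) -> \bar R}) (alpha : R).

Definition b_const : R := 2 `^ (alpha / 2) * Gamma_fun (1 + alpha / 2).

(* An improper integral: it converges only conditionally for alpha <= 1. *)
Definition C_const : R :=
  (lim (Rintegral lebesgue_measure `[0, A]
          (fun x : R => x `^ (- alpha) * sin x) @[A --> +oo]))^-1.

Definition lepage_scale : R :=
  (C_const * b_const^-1 * fine (m [set: R])) `^ alpha^-1.

(* Sequences are indexed from 0: [Gam k] is the (k+1)-st arrival time. *)
Definition interarrival (Gam : nat -> T -> R) (k : nat) (w : T) : R :=
  if k is j.+1 then Gam j.+1 w - Gam j w else Gam 0%N w.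

Definition poisson_arrivals (Gam : nat -> {RV P >-> R}) : Prop :=
  forall k (B : set R), measurable B ->
    P (interarrival Gam k @^-1` B) = exponential_prob 1 B.

Definition lepage_family (Gam G1 G2 Z : nat -> T -> R)
    (i : (nat + nat) + (nat + nat)) : T -> R :=
  match i with
  | inl (inl k) => interarrival Gam k
  | inl (inr k) => Z k
  | inr (inl k) => G1 k
  | inr (inr k) => G2 k
  end.

Definition lepage_sequences (Gam G1 G2 Z : nat -> {RV P >-> R}) : Prop :=
  [/\ poisson_arrivals Gam,
      (forall k, has_law (G1 k) (normal_prob 0 1) /\
                 has_law (G2 k) (normal_prob 0 1)),
      (forall k, has_law (Z k)
         (fun B => ((fine (m [set: R]))^-1%:E * m B)%E)) &
      independent_RVs P (lepage_family Gam G1 G2 Z)].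

Definition amplitude (Gam G1 G2 : nat -> T -> R) (k : nat) (w : T) : R :=
  lepage_scale * Gam k w `^ (- alpha^-1) *
  Num.sqrt (G1 k w ^+ 2 + G2 k w ^+ 2).

(* The generators determine the argument of G1_k - i G2_k, so phases obtained
   that way are [sigma_A]-measurable; phases that are uniform conditionally on
   [sigma_A] have to be independent of it. *)
Definition sigma_A (Gam G1 G2 Z : nat -> T -> R) : set_system T :=
  sigma_gen (fun i : nat + (nat + nat) =>
    match i with
    | inl k => Z k
    | inr (inl k) => fun w => Gam k w `^ (- alpha^-1) * G1 k w
    | inr (inr k) => fun w => Gam k w `^ (- alpha^-1) * G2 k w
    end).

Definition sigma_amp_freq (Gam G1 G2 Z : nat -> T -> R) : set_system T :=
  sigma_gen (fun i : nat + nat =>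
    match i with
    | inl k => amplitude Gam G1 G2 k
    | inr k => Z k
    end).

(* Amplitude-phase-frequency representation, realized on the space of [X]:
   i.i.d. uniform phases, independent of the amplitudes and frequencies.  The
   phases may be the arguments of
     A_k = 2^-1 * lepage_scale * Gam_k^(-1/alpha) * (G1_k - i G2_k),
   in which case the series is, term by term, that of
   lepage_scale * Gam_k^(-1/alpha) * (G1_k cos (t Z_k) + G2_k sin (t Z_k)),
   or a sequence independent of [sigma_A]; the joint law of [X], the amplitudes
   and the frequencies is the same. *)
Definition apf_representation (X : R -> T -> R)
    (Gam G1 G2 Z Theta : nat -> {RV P >-> R}) : Prop :=
  [/\ (forall k, has_law (Theta k) (uniform_prob (twopi_gt0 R))),
      independent_RVs P (fun k => Theta k : T -> R),
      independent2 P (sigma_amp_freq Gam G1 G2 Z)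
        (sigma_gen (fun k => Theta k : T -> R)) &
      forall t : R, {ae P, forall w,
        (fun n => \sum_(k < n)
           amplitude Gam G1 G2 k w * cos (Theta k w + t * Z k w))
        @ \oo --> X t w}].

Definition bessel_partial (lambda : R) (Gam G1 G2 : nat -> T -> R) (w : T)
    (n : nat) : R[i]^o :=
  \prod_(k < n) besselJ0 (lambda * amplitude Gam G1 G2 k w).

Definition bessel_product (lambda : R) (Gam G1 G2 : nat -> T -> R) (w : T)
    : R[i]^o :=
  lim (bessel_partial lambda Gam G1 G2 w @ \oo).

End series_representation.

Definition time_average (R : realType) (x : R -> R) (lambda A : R) : R[i]^o :=
  (A^-1)%:C *
  cintegral lebesgue_measure `[0, A] (fun tau : R => expi (lambda * x tau)).

(* Main.v *)
Require Import Defs.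
From HB Require Import structures.
From mathcomp Require Import all_boot all_order all_algebra.
From mathcomp Require Import all_classical all_reals all_analysis.
From mathcomp Require Import complex.
From mathcomp Require Import measurable_realfun.
From mathcomp Require Import ring lra.
Import Order.TTheory GRing.Theory Num.Theory.
Import numFieldNormedType.Exports.
Set Implicit Arguments.
Unset Strict Implicit.
Unset Printing Implicit Defensive.
Local Open Scope classical_set_scope.
Local Open Scope ring_scope.
Local Open Scope complex_scope.

(** Let S_n(t) be the sum of the first n terms R_k cos(Theta_k + t Z_k).  The time
    averages of exp(i lambda S_n) are computed path by path for each fixed n; the
    difficulty is to let n tend to infinity under the average.  The series
    converges almost surely at each fixed time, in general not absolutely, and
    this alone gives no control that is uniform over long time intervals.

    Everything random is handled through one fact: given the amplitudes, the
    frequencies and all the other phases, a single phase is uniform and can be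
    integrated out ([others_integral]).  A first consequence is that adding to
    the phases arbitrary functions of the amplitudes and the frequencies does
    not change the joint law ([phase_shift]).  Adding Z_k to the k-th phase
    moves the whole picture on by one unit of time, so that any functional of
    the partial sums is stationary along integer times.

    For fixed n the frequencies Z_0, ..., Z_(n-1), being independent with a
    diffuse law, are almost surely rationally independent
    ([ae_rationally_independent]).  By Weyl's argument the angles
    Theta_k + t Z_k are then equidistributed on the torus, and the time average
    of exp(i lambda S_n) is the product of the J_0(lambda R_k) for k < n
    ([equidistribution]).

    For uniformity in time, consider the largest distance, truncated at 1,
    between S_n and the later partial sums, averaged over a unit interval of
    time.  Along integer times this is a stationary sequence, and Garsia's proof
    of the maximal ergodic inequality applies ([garsia]): the probability that
    some average of the sequence exceeds a is at most 1/a times its mean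
    ([maximal_oscillation]).  The mean tends to 0 as n grows, by dominated
    convergence ([mean_tail_cvg0]).  Hence, almost surely, for every a > 0 there
    is an n such that, for every m >= n, the truncated distance between S_m and
    S_n is at most a on average over every interval from 0 to K
    ([ae_oscillation_small]).  The partial Bessel products, being the mean values
    for the S_n, thus form a Cauchy sequence, whose limit is the mean value for X
    ([mean_value_limit], [ae_time_average]).

    For the conditional expectation, the phases are integrated out one after
    the other over an event of the conditioning sigma-algebra
    ([integrate_phases]), each of them contributing a factor J_0, and n tends to
    infinity by dominated convergence ([Rintegral_limit]). *)

(** * Translations of Lebesgue and uniform measures *)

Lemma lebesgue_measure_shift (R : realType) (a : R) (A : set R) : measurable A ->
  lebesgue_measure ((fun x : R => x + a) @^-1` A) = lebesgue_measure A.
Proof.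
move=> mA.
have mf : measurable_fun [set: measurableTypeR R]
    ((fun x : R => x + a) : measurableTypeR R -> measurableTypeR R).
  by apply: measurable_funD.
apply/esym.
apply: (@lebesgue_measure_unique _ (pushforward lebesgue_measure
  ((fun x : R => x + a) : measurableTypeR R -> measurableTypeR R))) => //= _ [[u v]] _ <-.
rewrite /pushforward (_ : _ @^-1` _ = `]u - a, v - a]%classic); last first.
  by apply/seteqP; split => x /=; rewrite !in_itv/= ltrBlDr lerBrDr.
by rewrite !lebesgue_measure_itv/= !lte_fin ltrD2r -!EFinB opprB addrA subrK.
Qed.

Lemma ge0_integral_shift (R : realType) (a : R) (D : set R) (h : R -> \bar R) :
  measurable D -> measurable_fun [set: R] h -> (forall x, 0 <= h x)%E ->
  (\int[lebesgue_measure]_(x in (fun x : R => (x + a)%R) @^-1` D) h (x + a)%R =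
   \int[lebesgue_measure]_(x in D) h x)%E.
Proof.
move=> mD mh h0.
have mf : measurable_fun [set: measurableTypeR R]
    ((fun x : R => x + a) : measurableTypeR R -> measurableTypeR R).
  by apply: measurable_funD.
rewrite -(@ge0_integral_pushforward _ _ _ _ _ _ mf lebesgue_measure D h)//; last first.
  exact: measurable_funTS.
apply: eq_measure_integral => //= A mA _.
exact: lebesgue_measure_shift.
Qed.

Lemma periodic_int (R : realType) (T : Type) (p : R) (h : R -> T) :
  (forall x, h (x + p) = h x) -> forall (k : int) x, h (x + p *~ k) = h x.
Proof.
move=> hp.
have hn (n : nat) x : h (x + p *+ n) = h x.
  elim: n => [|n IH]; first by rewrite mulr0n addr0.
  by rewrite mulrSr addrA hp.
move=> [n|n] x; first by rewrite -pmulrn hn.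
by rewrite NegzE mulrNz -pmulrn -(hn n.+1) subrK.
Qed.

(** Translating by [a], modulo the period, only permutes the two parts into
    which a point cuts the circle. *)
Lemma ge0_integral_periodic_shift (R : realType) (p a : R) (h : R -> \bar R) :
  0 < p -> measurable_fun [set: R] h -> (forall x, 0 <= h x)%E ->
  (forall x, h (x + p) = h x) ->
  (\int[lebesgue_measure]_(x in `[0%R, p[) h (x + a)%R =
   \int[lebesgue_measure]_(x in `[0%R, p[) h x)%E.
Proof.
move=> p0 mh h0 hp.
wlog a0 : a / 0 <= a < p.
  pose k := Num.floor (a / p).
  move=> /(_ (a - p *~ k)) <-; last first.
    rewrite subr_ge0 ltrBlDl -mulrzr; apply/andP; split.
      by rewrite -ler_pdivlMl// mulrC floor_le.
    rewrite (_ : p * _ + p = p * (k%:~R + 1)); last by rewrite mulrDr mulr1.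
    by rewrite -ltr_pdivrMl// mulrC -intrD1 floorD1_gt.
  apply: eq_integral => x _; rewrite addrA -[RHS](periodic_int hp k).
  by rewrite subrK.
have /andP[a1 a2] := a0.
have mI (u v : R) : measurable (`[u, v[%classic : set R) by exact: measurable_itv.
have mhS (D : set R) : measurable_fun D h by exact: measurable_funTS.
transitivity (\int[lebesgue_measure]_(x in `[a, (a + p)%R[) h x)%E.
  rewrite -(@ge0_integral_shift _ a `[a, (a + p)%R[ h)//; congr (integral _ _ _).
  by apply/seteqP; split => x /=; rewrite !in_itv/= [a + p]addrC ltrD2r lerDr.
have split_at (u v w : R) : u <= v <= w -> (\int[lebesgue_measure]_(x in `[u, w[) h x =
    \int[lebesgue_measure]_(x in `[u, v[) h x + \int[lebesgue_measure]_(x in `[v, w[) h x)%E.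
  move=> uvw; rewrite -ge0_integral_setU//; [|exact: mhS|].
    by congr (integral _ _ _); rewrite -itv_bndbnd_setU// bnd_simp; case/andP: uvw.
  apply/disj_setPS => x [/=]; rewrite !in_itv/= => /andP[_ xv] /andP[vx _].
  by move: (lt_le_trans xv vx); rewrite ltxx.
rewrite (split_at a p (a + p)) ?(ltW a2) ?lerDr// (split_at 0 a p) ?a1 ?(ltW a2)// addeC; congr (_ + _)%E.
rewrite -(@ge0_integral_shift _ p `[p, (a + p)%R[ h)//.
transitivity (\int[lebesgue_measure]_(x in `[0%R, a[) h (x + p)%R)%E.
  congr (integral _ _ _).
  by apply/seteqP; split => x /=; rewrite !in_itv/= ltrD2r lerDr.
by apply: eq_integral => x _; rewrite hp.
Qed.

Lemma uniform_prob_shift (R : realType) (a : R) (h : R -> \bar R) :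
  measurable_fun [set: R] h -> (forall x, 0 <= h x)%E ->
  (forall x, h (x + 2 * pi)%R = h x) ->
  (\int[uniform_prob (twopi_gt0 R)]_x h (x + a)%R =
   \int[uniform_prob (twopi_gt0 R)]_x h x)%E.
Proof.
move=> mh h0 hp; have mh' : measurable_fun [set: R] (fun x => h (x + a)).
  by apply: measurableT_comp => //; apply: measurable_funD.
rewrite !integral_uniform//; congr (_ * _)%E.
rewrite -!integral_itv_bndo_bndc; [|exact: measurable_funTS..].
exact: ge0_integral_periodic_shift (twopi_gt0 R) mh h0 hp.
Qed.

(** * Independence and integration *)

(** Both sides are finite measures in [A], and they agree on a pi-system. *)
Lemma indep_generated d (T : measurableType d) (R : realType)
    (P : probability T R) (G : set_system T) (B : set T) :
  setI_closed G -> G `<=` measurable -> G [set: T] -> measurable B ->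
  (forall A, G A -> P (A `&` B) = (P A * P B)%E) ->
  forall A, <<s G >> A -> P (A `&` B) = (P A * P B)%E.
Proof.
move=> GI Gm GT mB indep A GA.
have pB : 0 <= fine (P B) by exact: fine_ge0.
have PBfin : P B \is a fin_num by exact: fin_num_measure.
transitivity (mscale (NngNum pB) P A); last first.
  by rewrite /mscale/= fineK// muleC.
rewrite -[LHS]/(mrestr P mB A).
apply: (@g_sigma_algebra_measure_unique _ R T G Gm (fun=> setT) _ _
  (mrestr P mB) (mscale (NngNum pB) P)) => //.
- by rewrite bigcup_const.
- move=> C GC; rewrite -[LHS]/(P (C `&` B)) indep//.
  by rewrite -[RHS]/((fine (P B))%:E * P C)%E fineK// muleC.
- by move=> k; rewrite -[X in (X < _)%E]/(P (setT `&` B)) setTI ltey_eq PBfin.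
Qed.

(** The joint law of two independent variables is a product measure, so that
    one of them can be integrated out by Tonelli's theorem. *)
Lemma indep_integral d d1 d2 (T : measurableType d) (T1 : measurableType d1)
    (T2 : measurableType d2) (R : realType) (P : probability T R)
    (U : {RV P >-> T1}) (V : {RV P >-> T2}) (h : T1 * T2 -> \bar R) :
  (forall A B, measurable A -> measurable B ->
     P (U @^-1` A `&` V @^-1` B) = (P (U @^-1` A) * P (V @^-1` B))%E) ->
  measurable_fun [set: T1 * T2] h -> (forall x, 0 <= h x)%E ->
  (\int[P]_w h (U w, V w) = \int[P]_w \int[distribution P V]_y h (U w, y))%E.
Proof.
move=> indep mh h0.
have mUV : measurable_fun setT (fun w => (U w, V w)) by exact: measurable_fun_pair.
pose UV : {mfun T >-> (T1 * T2)%type} := HB.pack (fun w => (U w, V w))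
   (isMeasurableFun.Build _ _ _ _ _ mUV).
transitivity (\int[distribution P UV]_z h z)%E.
  by rewrite ge0_integral_distribution.
rewrite (@eq_measure_integral _ _ _ _ (distribution P U \x distribution P V)%E).
  rewrite fubini_tonelli1//.
  rewrite /fubini_F ge0_integral_distribution//.
    exact: measurable_fun_fubini_tonelli_F.
  by move=> y; exact: integral_ge0.
move=> A mA _; apply/esym; apply: product_measure_unique => // B C mB mC.
Qed.

Section integrating_out.
Context d (T : measurableType d) (R : realType) (P : probability T R).

(** The first variable is the identity of [T], seen as a map into [T] with the
    smaller sigma-algebra generated by [G]. *)
Lemma indep_sigma_integral (G : set_system T) (V : {RV P >-> R})
    (h : g_sigma_algebraType G * R -> \bar R) :
  G `<=` measurable ->
  (forall A B, <<s G >> A -> measurable B ->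
     P (A `&` V @^-1` B) = (P A * P (V @^-1` B))%E) ->
  measurable_fun [set: g_sigma_algebraType G * R] h -> (forall x, 0 <= h x)%E ->
  (\int[P]_w h (w, V w) = \int[P]_w \int[distribution P V]_y h (w, y))%E.
Proof.
move=> Gm indep mh h0.
have mid : measurable_fun [set: T] (id : T -> g_sigma_algebraType G).
  move=> _ A sA; rewrite setTI preimage_id.
  exact: (smallest_sub (@sigma_algebra_measurable _ T) Gm sA).
pose U : {RV P >-> g_sigma_algebraType G} := HB.pack (id : T -> g_sigma_algebraType G)
   (isMeasurableFun.Build _ _ _ _ _ mid).
by apply: (@indep_integral _ _ _ _ _ _ _ _ U V) => // A B mA mB; exact: indep.
Qed.

(** Cylinders form a pi-system, on which independence from [Y k] is a product
    formula. *)
Definition others_system (F : set_system T) (Y : nat -> T -> R) (N k : nat) :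
    set_system T :=
  [set C | exists A (B : nat -> set R), [/\ F A, forall j, measurable (B j) &
    C = A `&` \bigcap_(j in [set` [seq j <- iota 0 N | j != k]]) Y j @^-1` B j]].

Definition others (F : set_system T) (Y : nat -> T -> R) (N k : nat) :=
  g_sigma_algebraType (others_system F Y N k).

Variables (F : set_system T) (Y : nat -> {RV P >-> R}).
Hypotheses (FI : setI_closed F) (FT : F [set: T]) (Fm : F `<=` measurable).

Lemma others_measurable (N k : nat) : others_system F Y N k `<=` measurable.
Proof.
move=> _ [A [B [FA mB ->]]]; apply: measurableI; first exact: Fm.
apply: fin_bigcap_measurable => // j _.
by rewrite -[_ @^-1` _]setTI; exact: measurable_funP.
Qed.

Lemma others_rv_measurable (N k j : nat) : (j < N)%N -> j != k ->
  measurable_fun setT (Y j : others F Y N k -> R).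
Proof.
move=> jN jk _ B mB; rewrite setTI; apply: sub_sigma_algebra.
exists setT, (fun i => if i == j then B else setT); split => //.
  by move=> i; case: ifP.
rewrite setTI; apply/seteqP; split => w /=.
  by move=> Bw i _ /=; case: eqP => [->|].
by move/(_ j); rewrite /= eqxx; apply; rewrite mem_filter jk mem_iota.
Qed.

Lemma others_sys_measurable (N k : nat) (f : T -> R) :
  (forall B : set R, measurable B -> F (f @^-1` B)) ->
  measurable_fun setT (f : others F Y N k -> R).
Proof.
move=> mf _ B mB; rewrite setTI; apply: sub_sigma_algebra.
exists (f @^-1` B), (fun=> setT); split => //; first exact: mf.
by rewrite bigcapT ?setIT//; apply/seteqP; split.
Qed.

Hypothesis indepY : independent_RVs P (fun j => Y j : T -> R).
Hypothesis indepFY : independent2 P F (sigma_gen (fun j => Y j : T -> R)).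

Lemma others_indep (N k : nat) (A : set T) (B : set R) :
  <<s others_system F Y N k >> A -> measurable B ->
  P (A `&` Y k @^-1` B) = (P A * P (Y k @^-1` B))%E.
Proof.
move=> sA mB; move: A sA; apply: indep_generated.
- move=> _ _ [A1 [B1 [FA1 mB1 ->]]] [A2 [B2 [FA2 mB2 ->]]].
  exists (A1 `&` A2), (fun j => B1 j `&` B2 j); split.
  + exact: FI.
  + by move=> j; exact: measurableI.
  + by rewrite setIACA -bigcapI.
- exact: others_measurable.
- exists setT, (fun=> setT); split => //.
  by rewrite setTI; apply/seteqP; split.
- by rewrite -[_ @^-1` _]setTI; exact: measurable_funP.
move=> _ [A [C [FA mC ->]]].
set s := [seq j <- iota 0 N | j != k].
pose C' j := if j == k then B else C j.
have us : uniq (k :: s) by rewrite /= mem_filter eqxx/= filter_uniq// iota_uniq.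
have mC' j : preimage_set_system [set: T] (Y j) measurable (Y j @^-1` C' j).
  by exists (C' j); rewrite ?setTI// /C'; case: ifP.
have E : \bigcap_(j in [set` s]) Y j @^-1` C j = \bigcap_(j in [set` s]) Y j @^-1` C' j.
  apply: eq_bigcapr => j /=; rewrite mem_filter => /andP[jk _].
  by rewrite /C' (negbTE jk).
have sY j : sigma_gen (fun j => Y j : T -> R) (Y j @^-1` C' j).
  by apply: sub_sigma_algebra; exists j.
have EK : \bigcap_(j in [set` k :: s]) Y j @^-1` C' j =
    \bigcap_(j in [set` s]) Y j @^-1` C j `&` Y k @^-1` B.
  rewrite E; apply/seteqP; split => w /=.
    move=> h; split; first by move=> j js; apply: h; rewrite /= in_cons js orbT.
    by have := h k; rewrite /= /C' eqxx; apply; rewrite in_cons eqxx.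
  move=> [h1 h2] j /=; rewrite in_cons => /orP[/eqP ->|]; last exact: h1.
  by rewrite /C' eqxx.
have sI (l : seq nat) : sigma_gen (fun j => Y j : T -> R)
    (\bigcap_(j in [set` l]) Y j @^-1` C' j).
  apply: (@fin_bigcap_measurable _ (g_sigma_algebraType
    (\bigcup_j preimage_set_system [set: T] (Y j : T -> R) measurable))).
    exact: finite_seq.
  by move=> j _; exact: sY.
(* The family is independent both with [k], after merging the event on [Y k]
   into the cylinder, and without it. *)
rewrite -setIA -EK indepFY// E indepFY// -muleA; congr (_ * _)%E.
rewrite indepY// indepY//; last by case/andP: us.
have CK : C' k = B by rewrite /C' eqxx.
by rewrite big_cons CK muleC.
Qed.

Lemma others_integral (N k : nat) (h : others F Y N k * R -> \bar R) :
  measurable_fun [set: others F Y N k * R] h -> (forall x, 0 <= h x)%E ->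
  (\int[P]_w h (w, Y k w) = \int[P]_w \int[distribution P (Y k)]_y h (w, y))%E.
Proof.
apply: indep_sigma_integral; first exact: others_measurable.
by move=> A B; exact: others_indep.
Qed.

End integrating_out.

Lemma integral_law d (T : measurableType d) (R : realType) (P : probability T R)
    (V : {RV P >-> R}) (mu : {measure set (measurableTypeR R) -> \bar R})
    (h : R -> \bar R) :
  has_law V mu -> measurable_fun [set: R] h -> (forall x, 0 <= h x)%E ->
  (\int[distribution P V]_y h y = \int[mu]_y h y)%E.
Proof.
move=> lawV mh h0.
have mid : measurable_fun [set: measurableTypeR R] (id : measurableTypeR R -> R) by [].
rewrite -[RHS](ge0_integral_pushforward mid mu measurableT mh)//.
by apply: eq_measure_integral => A mA _; exact: lawV.
Qed.

(** * Invariance under shifts of the phases *)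

(** Measurability is required after substitution of measurable families on
    every measurable space, which avoids any measurable structure on the space of
    sequences. *)
Definition measurable_functional (R : realType)
    (phi : (nat -> R) -> (nat -> R) -> (nat -> R) -> \bar R) : Prop :=
  forall d (E : measurableType d) (r z th : nat -> E -> R),
    (forall k, measurable_fun setT (r k)) ->
    (forall k, measurable_fun setT (z k)) ->
    (forall k, measurable_fun setT (th k)) ->
    measurable_fun setT (fun e => phi (r ^~ e) (z ^~ e) (th ^~ e)).

Section phase_shift.
Context d (T : measurableType d) (R : realType) (P : probability T R).
Variables (F : set_system T) (Y : nat -> {RV P >-> R}) (r z a : nat -> T -> R).
Hypotheses (FI : setI_closed F) (FT : F [set: T]) (Fm : F `<=` measurable).
Hypothesis indepY : independent_RVs P (fun j => Y j : T -> R).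
Hypothesis indepFY : independent2 P F (sigma_gen (fun j => Y j : T -> R)).
Hypothesis unifY : forall k, has_law (Y k) (uniform_prob (twopi_gt0 R)).
Hypothesis rF : forall k (B : set R), measurable B -> F (r k @^-1` B).
Hypothesis zF : forall k (B : set R), measurable B -> F (z k @^-1` B).
Hypothesis aF : forall k (B : set R), measurable B -> F (a k @^-1` B).

(** One phase is shifted at a time: given [F] and the other phases it is uniform,
    and the mean of a periodic function does not change under translation. *)
Lemma phase_shift (N : nat)
    (phi : (nat -> R) -> (nat -> R) -> (nat -> R) -> \bar R) :
  measurable_functional phi -> (forall r z th, 0 <= phi r z th)%E ->
  (forall r z th th', (forall j, (j < N)%N -> th j = th' j) ->
     phi r z th = phi r z th') ->
  (forall r z th k, phi r z (fun j => if j == k then th j + 2 * pi else th j) =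
     phi r z th) ->
  (\int[P]_w phi (r ^~ w) (z ^~ w) (fun j => Y j w + a j w)%R =
   \int[P]_w phi (r ^~ w) (z ^~ w) (Y ^~ w))%E.
Proof.
move=> mphi phi0 phiN phiP.
(* The phases after the first [k] of them have been shifted. *)
pose Th k w j := Y j w + (if (j < k)%N then a j w else 0).
have step k : (k < N)%N ->
    (\int[P]_w phi (r ^~ w) (z ^~ w) (Th k.+1 w) =
     \int[P]_w phi (r ^~ w) (z ^~ w) (Th k w))%E.
  move=> kN; pose O := others F Y N k.
  pose h (x : O * R) := phi (r ^~ (x.1 : T)) (z ^~ (x.1 : T))
    (fun j => if j == k then x.2 else if (j < N)%N then Th k x.1 j else 0).
  have mO (f : T -> R) : measurable_fun setT (f : O -> R) ->
      measurable_fun [set: O * R] (fun x => f x.1).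
    by move=> mf; exact: measurableT_comp mf measurable_fst.
  have mF (f : T -> R) : (forall B : set R, measurable B -> F (f @^-1` B)) ->
      measurable_fun [set: O * R] (fun x => f x.1).
    by move=> mf; apply: mO; exact: others_sys_measurable.
  have mh : measurable_fun [set: O * R] h.
    apply: mphi => j; [exact: (mF (r j) (rF j))|exact: (mF (z j) (zF j))|].
    case: eqVneq => [_|jk]; first exact: measurable_snd.
    case: ltnP => [jN|_]; last exact: measurable_cst.
    rewrite /Th; apply: measurable_funD.
      by apply: mO; exact: others_rv_measurable.
    by case: (j < k)%N; [exact: (mF (a j) (aF j))|exact: measurable_cst].
  have h0 x : (0 <= h x)%E by exact: phi0.
  pose h1 (x : O * R) := h (x.1, x.2 + a k x.1).
  have mh1 : measurable_fun [set: O * R] h1.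
    apply: measurableT_comp => //; apply: measurable_fun_pair => //.
    by apply: measurable_funD => //; exact: (mF (a k) (aF k)).
  transitivity (\int[P]_w h1 (w, Y k w))%E.
    apply: eq_integral => w _; apply: phiN => j jN /=; rewrite /Th jN.
    by case: eqVneq => [->|jk]; rewrite ?ltnS ?leqnn// ltn_neqAle jk.
  transitivity (\int[P]_w h (w, Y k w))%E; last first.
    apply: eq_integral => w _; apply: phiN => j jN /=; rewrite /Th jN.
    by case: eqVneq => [->|//]; rewrite ltnn addr0.
  have h10 x : (0 <= h1 x)%E by exact: h0.
  rewrite (others_integral FI FT Fm indepY indepFY mh1 h10).
  rewrite (others_integral FI FT Fm indepY indepFY mh h0).
  apply: eq_integral => w _.
  have mhw : measurable_fun [set: R] (fun y => h (w, y)).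
    exact: (measurableT_comp mh (pair1_measurable (w : O))).
  rewrite !(integral_law (unifY k))//; last exact: (measurableT_comp mh1 (pair1_measurable (w : O))).
  rewrite -(uniform_prob_shift (a k w) mhw)// => y.
  rewrite /h/= -[RHS](phiP _ _ _ k); apply: phiN => j _ /=.
  by case: ifP.
transitivity (\int[P]_w phi (r ^~ w) (z ^~ w) (Th N w))%E.
  by apply: eq_integral => w _; apply: phiN => j jN; rewrite /Th jN.
have -> : (\int[P]_w phi (r ^~ w) (z ^~ w) (Y ^~ w) =
    \int[P]_w phi (r ^~ w) (z ^~ w) (Th 0%N w))%E.
  by apply: eq_integral => w _; apply: phiN => j _; rewrite /Th addr0.
have : (N <= N)%N by [].
elim: {1 3}N => [//|k IH] kN; rewrite step//; apply: IH; exact: ltnW.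
Qed.

End phase_shift.

(** * Mean values of almost periodic functions *)

Section mean_value.
Context (R : realType).
Notation mu := (@lebesgue_measure R).
Implicit Types (g h : R -> R) (c : R).

Definition bounded_measurable g :=
  measurable_fun [set: R] g /\ exists M : R, forall x, `|g x| <= M.

Lemma bounded_measurable_integrable (d : measure_display) (T : measurableType d)
    (m : {measure set T -> \bar R}) (D : set T) (g : T -> R) (M : R) :
  measurable D -> (m D < +oo)%E -> measurable_fun [set: T] g ->
  (forall x, `|g x| <= M) -> m.-integrable D (EFin \o g).
Proof.
move=> mD Dfin mg gM; apply: measurable_bounded_integrable => //.
  exact: measurable_funTS.
by exists M; split; rewrite ?num_real// => y My x _ /=; exact: le_trans (gM x) (ltW My).
Qed.

Lemma bm_integrable (a b : R) g : bounded_measurable g ->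
  mu.-integrable `[a, b] (EFin \o g).
Proof.
move=> [mg [M gM]].
apply: (@bounded_measurable_integrable _ (measurableTypeR R) _ _ _ M) => //.
rewrite [X in (X < _)%E](_ : _ = lebesgue_measure `[a, b])// lebesgue_measure_itv/=.
by case: ifP => _ //; rewrite -EFinB ltry.
Qed.

Lemma bmD g h : bounded_measurable g -> bounded_measurable h ->
  bounded_measurable (fun x => g x + h x).
Proof.
move=> [mg [M gM]] [mh [N hN]]; split; first exact: measurable_funD.
exists (M + N) => x; apply: le_trans (ler_normD _ _) _; exact: lerD.
Qed.

Lemma bmM g h : bounded_measurable g -> bounded_measurable h ->
  bounded_measurable (fun x => g x * h x).
Proof.
move=> [mg [M gM]] [mh [N hN]]; split; first exact: measurable_funM.
by exists (M * N) => x; rewrite normrM; apply: ler_pM.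
Qed.

Lemma bm_cst c : bounded_measurable (fun=> c).
Proof. by split; [exact: measurable_cst|exists `|c|]. Qed.

Lemma bm_cos h : measurable_fun [set: R] h -> bounded_measurable (fun x => cos (h x)).
Proof.
move=> mh; split; last by exists 1 => x; rewrite ler_norml cos_geN1 cos_le1.
by apply: measurableT_comp mh; apply: continuous_measurable_fun; exact: continuous_cos.
Qed.

Lemma bm_sin h : measurable_fun [set: R] h -> bounded_measurable (fun x => sin (h x)).
Proof.
move=> mh; split; last by exists 1 => x; rewrite ler_norml sin_geN1 sin_le1.
by apply: measurableT_comp mh; apply: continuous_measurable_fun; exact: continuous_sin.
Qed.

Lemma Rintegral_cst_itv (a b c : R) : a <= b ->
  (\int[mu]_(x in `[a, b]) c)%R = c * (b - a).
Proof.
move=> ab; rewrite Rintegral_cst//; congr (_ * _).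
rewrite [X in fine X](_ : _ = lebesgue_measure `[a, b])// lebesgue_measure_itv/=.
case: ltP => [//|]; rewrite lee_fin => ba /=.
by rewrite (le_anti (_ : a <= b <= a)) ?subrr// ab.
Qed.

Lemma le_dist_Rintegral (a b e : R) g h : a <= b ->
  bounded_measurable g -> bounded_measurable h ->
  (forall x, `|g x - h x| <= e) ->
  `|(\int[mu]_(x in `[a, b]) g x)%R - (\int[mu]_(x in `[a, b]) h x)%R| <= e * (b - a).
Proof.
move=> ab bg bh gh.
have ig := bm_integrable a b bg; have ih := bm_integrable a b bh.
rewrite -RintegralB//.
have bgh : bounded_measurable (fun x => g x - h x).
  have := bmD bg (bmM (bm_cst (-1)) bh).
  by congr bounded_measurable; apply/funext => x /=; rewrite mulN1r.
apply: le_trans (le_normr_Rintegral _ (bm_integrable a b bgh)) _ => //.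
rewrite -Rintegral_cst_itv//; apply: le_Rintegral => //.
  case: bgh => mgh [M ghM]; apply: (@bm_integrable a b (fun x => `|g x - h x|)).
  split; first by apply: measurableT_comp.
  by exists M => x; rewrite normr_id.
exact: (bm_integrable a b (bm_cst e)).
Qed.

Lemma Rintegral_lin (a b s s' : R) g h :
  bounded_measurable g -> bounded_measurable h ->
  (\int[mu]_(x in `[a, b]) (s * g x + s' * h x))%R =
  s * (\int[mu]_(x in `[a, b]) g x)%R + s' * (\int[mu]_(x in `[a, b]) h x)%R.
Proof.
move=> bg bh; rewrite RintegralD//.
- by rewrite !RintegralZl//; exact: bm_integrable.
- exact: (bm_integrable a b (bmM (bm_cst s) bg)).
- exact: (bm_integrable a b (bmM (bm_cst s') bh)).
Qed.

Definition mean_value g c :=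
  A^-1 * (\int[mu]_(x in `[0, A]) g x)%R @[A --> +oo] --> c.

Lemma mean_value_lin (s s' c c' : R) g h :
  bounded_measurable g -> bounded_measurable h ->
  mean_value g c -> mean_value h c' ->
  mean_value (fun t => s * g t + s' * h t) (s * c + s' * c').
Proof.
move=> bg bh mg mh; rewrite /mean_value.
under eq_fun do rewrite Rintegral_lin// mulrDr [_ * (s * _)]mulrCA [_ * (s' * _)]mulrCA.
exact: cvgD (cvgM (cvg_cst s) mg) (cvgM (cvg_cst s') mh).
Qed.

Lemma mean_value_cst c : mean_value (fun=> c) c.
Proof.
apply: (@cvg_near_cst _ _ _ _ (nbhs +oo)%R); near=> A.
have A0 : 0 < A by near: A; exact: nbhs_pinfty_gt.
by rewrite Rintegral_cst_itv ?ltW// subr0 mulrC mulfK// gt_eqF.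
Unshelve. all: by end_near. Qed.

(** Averaging over an interval is a contraction for the uniform distance. *)
Lemma mean_value_uniform g c : bounded_measurable g ->
  (forall e, 0 < e -> exists h c', [/\ bounded_measurable h, mean_value h c',
     `|c' - c| <= e & forall t, `|g t - h t| <= e]) ->
  mean_value g c.
Proof.
move=> bg approx; apply/cvgrPdist_lt => e e0.
have e4 : 0 < e / 4 by rewrite divr_gt0.
have [h [c' [bh mh cc' gh]]] := approx _ e4.
near=> A.
have A0 : 0 < A by near: A; exact: nbhs_pinfty_gt.
have h1 : `|c' - A^-1 * (\int[mu]_(x in `[0, A]) h x)%R| < e / 4.
  by near: A; move/cvgrPdist_lt : mh; exact.
have h2 : `|A^-1 * (\int[mu]_(x in `[0, A]) g x)%R -
            A^-1 * (\int[mu]_(x in `[0, A]) h x)%R| <= e / 4.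
  rewrite -mulrBr normrM gtr0_norm ?invr_gt0// ler_pdivrMl// mulrC.
  by have := @le_dist_Rintegral 0 A (e / 4) g h (ltW A0) bg bh gh; rewrite subr0.
move: h1 h2 cc'; set x := A^-1 * _; set y := A^-1 * _.
rewrite !(distrC _ y) !ltr_norml !ler_norml => /andP[? ?] /andP[? ?] /andP[? ?].
apply/andP; split; lra.
Unshelve. all: by end_near. Qed.

Lemma Rintegral_cos (xi om a b : R) : xi != 0 -> a < b ->
  (\int[mu]_(t in `[a, b]) cos (xi * t + om))%R =
  xi^-1 * (sin (xi * b + om) - sin (xi * a + om)).
Proof.
move=> xi0 ab; pose G : R -> R := xi^-1 \*: (@sin R \o (xi \*: id + cst om)).
have dG (t : R) : is_derive t (1 : R) G (cos (xi * t + om)).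
  rewrite /G; apply: is_derive_eq.
  rewrite addr0 /= /GRing.scale/= mulr1 mulrCA mulVf// mulr1.
  by congr cos.
have G' : {in `]a, b[, derive1 G =1 fun t => cos (xi * t + om)}.
  by move=> t _; rewrite derive1E derive_val.
have cc : continuous (fun t : R => cos (xi * t + om)).
  move=> t; apply: continuous_comp; last exact: continuous_cos.
  by apply: cvgD; [apply: cvgM; [exact: cvg_cst|exact: cvg_id]|exact: cvg_cst].
have cG : continuous G.
  by move=> t; apply: differentiable_continuous; apply/derivable1_diffP; exact: ex_derive.
rewrite /Rintegral (continuous_FTC2 ab _ _ G')/=.
- by rewrite /G/= /GRing.scale/= -mulrBr.
- exact: continuous_subspaceT.
- split; first by move=> x _; exact: ex_derive.
  + by apply: cvg_at_right_filter; exact: cG.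
  + by apply: cvg_at_left_filter; exact: cG.
Qed.

(** The primitives of a cosine of nonzero frequency are bounded. *)
Lemma mean_value_cos (xi om : R) : xi != 0 ->
  mean_value (fun t => cos (xi * t + om)) 0.
Proof.
move=> xi0; apply/cvgrPdist_le => e e0; near=> A.
have A0 : 0 < A by near: A; exact: nbhs_pinfty_gt.
rewrite Rintegral_cos// mulr0 !add0r normrN !normrM gtr0_norm ?invr_gt0//.
rewrite ler_pdivrMl//.
have h : `|sin (xi * A + om) - sin om| <= 2.
  have := sin_geN1 om; have := sin_le1 om.
  have := sin_geN1 (xi * A + om); have := sin_le1 (xi * A + om).
  by rewrite ler_norml => ? ? ? ?; apply/andP; split; lra.
apply: le_trans (_ : `|xi^-1| * 2 <= _); first by rewrite ler_wpM2l.
rewrite -ler_pdivrMr//; near: A; exact: nbhs_pinfty_ge.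
Unshelve. all: by end_near. Qed.

End mean_value.

(** * Averages over a period *)

Section period_average.
Context (R : realType).
Notation mu := (@lebesgue_measure R).

Definition period_average (p : R -> R) : R :=
  (2 * pi)^-1 * (\int[mu]_(u in `[- pi, pi]) p u)%R.

Lemma Npi_lt_pi : - pi < pi :> R.
Proof. by rewrite ltrNl -subr_gt0 opprK addr_gt0 ?pi_gt0. Qed.

Lemma period_average_lin (s s' : R) (p q : R -> R) :
  bounded_measurable p -> bounded_measurable q ->
  period_average (fun u => s * p u + s' * q u) =
  s * period_average p + s' * period_average q.
Proof. by move=> bp bq; rewrite /period_average Rintegral_lin//; ring. Qed.

Lemma period_average_cst (c : R) : period_average (fun=> c) = c.
Proof.
rewrite /period_average Rintegral_cst_itv ?(ltW Npi_lt_pi)// opprK mulrC.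
have -> : pi + pi = 2 * pi :> R by ring.
by rewrite mulfK// gt_eqF// twopi_gt0.
Qed.

Lemma period_average_near (e : R) (p q : R -> R) :
  bounded_measurable p -> bounded_measurable q -> (forall u, `|p u - q u| <= e) ->
  `|period_average p - period_average q| <= e.
Proof.
move=> bp bq pq; rewrite /period_average -mulrBr normrM.
rewrite gtr0_norm ?invr_gt0 ?twopi_gt0// ler_pdivrMl ?twopi_gt0//.
have := @le_dist_Rintegral R (- pi) pi e p q (ltW Npi_lt_pi) bp bq pq.
by rewrite opprK mulrC (_ : pi + pi = 2 * pi)//; ring.
Qed.

Lemma sin_int_pi (l : int) : sin (l%:~R * pi : R) = 0.
Proof.
have hn (n : nat) : sin (n%:R * pi : R) = 0.
  elim: n => [|n IH]; first by rewrite mul0r sin0.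
  by rewrite -natr1 mulrDl mul1r sinD sinpi IH mul0r mulr0 addr0.
by case: l => n; rewrite ?NegzE ?mulrNz ?mulNr ?sinN -?pmulrn hn ?oppr0.
Qed.

Lemma period_average_cos (l : int) :
  period_average (fun u => cos (l%:~R * u)) = (l == 0)%:R.
Proof.
case: eqVneq => [->|l0].
  rewrite -[RHS](period_average_cst 1); congr (_ * _).
  by apply: eq_Rintegral => u _; rewrite mul0r cos0.
rewrite /period_average; under eq_Rintegral do rewrite -[_ * _]addr0.
rewrite Rintegral_cos ?intr_eq0 ?Npi_lt_pi// !addr0 mulrN sinN sin_int_pi.
by rewrite oppr0 subr0 !mulr0.
Qed.

End period_average.

(** * Trigonometric approximation *)

Section cosine_sums.
Context (R : realType).

(** Each pair holds a coefficient and an integer frequency. *)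
Definition cosine_sum (L : seq (R * int)) (u : R) : R :=
  \sum_(x <- L) x.1 * cos (x.2%:~R * u).

(** By the product-to-sum formula; it makes every polynomial in [cos u] a sum of
    cosines of multiples of [u]. *)
Lemma cosine_sum_mul_cos (L : seq (R * int)) :
  exists L', forall u, cosine_sum L' u = cosine_sum L u * cos u.
Proof.
elim: L => [|[c l] L [L' IH]].
  by exists [::] => u; rewrite /cosine_sum !big_nil mul0r.
exists [:: (c / 2, l + 1), (c / 2, l - 1) & L'] => u.
rewrite /cosine_sum !big_cons -!/(cosine_sum _ _) IH mulrDl addrA; congr (_ + _).
by rewrite /= intrD intrB mulrDl mulrBl mul1r cosD cosB; field.
Qed.

Lemma cosine_sum_horner (p : {poly R}) :
  exists L, forall u, cosine_sum L u = p.[cos u].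
Proof.
elim/poly_ind: p => [|p c [L IH]].
  by exists [::] => u; rewrite /cosine_sum big_nil horner0.
have [L' IH'] := cosine_sum_mul_cos L.
exists ((c, 0) :: L') => u; rewrite /cosine_sum big_cons -/(cosine_sum _ _) IH' IH.
by rewrite hornerMXaddC /= mul0r cos0 mulr1 addrC.
Qed.

Lemma bm_cosine_sum (L : seq (R * int)) (h : R -> R) : measurable_fun [set: R] h ->
  bounded_measurable (fun t => cosine_sum L (h t)).
Proof.
move=> mh; elim: L => [|x L IH].
  by rewrite /cosine_sum; under eq_fun do rewrite big_nil; exact: bm_cst.
rewrite /cosine_sum; under eq_fun do rewrite big_cons.
apply: bmD => //; apply: bmM; first exact: bm_cst.
by apply: bm_cos; apply: measurable_funM.
Qed.

(** A power series converges uniformly on bounded sets as soon as it is dominated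
    by the exponential series. *)
Lemma exp_dominated_approx (cf : nat -> R) (f : R -> R) (a e : R) :
  (forall n, `|cf n| <= (n`!%:R)^-1) ->
  (forall x, series (fun n => cf n * x ^+ n) @ \oo --> f x) ->
  0 < e -> exists p : {poly R}, forall x, `|x| <= a -> `|f x - p.[x]| <= e.
Proof.
move=> cfle cff e0; pose E := series (exp_coeff a).
have cE : E @ \oo --> expR a by exact: is_cvg_series_exp_coeff.
have [n _ En] : \forall n \near \oo, `|expR a - E n| < e.
  by move/cvgrPdist_lt : cE; exact.
exists (\poly_(i < n) cf i) => x xa; rewrite horner_poly.
have a0 : 0 <= a by exact: le_trans xa.
have ndE : nondecreasing_seq E.
  by apply/nondecreasing_series => i _ _; exact: exp_coeff_ge0.
have tail m : (n <= m)%N -> `|series (fun i => cf i * x ^+ i) m -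
    \sum_(i < n) cf i * x ^+ i| <= e.
  move=> nm; rewrite -(big_mkord xpredT (fun i => cf i * x ^+ i)).
  rewrite -[\sum_(0 <= i < n) _]/(series (fun i => cf i * x ^+ i) n) sub_series_geq//.
  apply: le_trans (ler_norm_sum _ _ _) _.
  apply: le_trans (_ : E m - E n <= _).
    rewrite sub_series_geq//; apply: ler_sum => i _.
    rewrite normrM normrX /exp_coeff/= mulrC; apply: ler_pM => //.
    by rewrite lerXn2r// nnegrE.
  have Em : E m <= expR a.
    by rewrite -(cvg_lim _ cE)//; apply: nondecreasing_cvgn_le => //; apply/cvg_ex; exists (expR a).
  have := En n (leqnn n); rewrite ltr_norml => /andP[_].
  by lra.
have cn : `|series (fun i => cf i * x ^+ i) m - \sum_(i < n) cf i * x ^+ i| @[m --> \oo]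
    --> `|f x - \sum_(i < n) cf i * x ^+ i|.
  by apply: cvg_norm; apply: cvgB; [exact: cff|exact: cvg_cst].
by apply: (cvgr_to_le cn); exists n.
Qed.

Lemma cos_approx (a e : R) : 0 < e ->
  exists p : {poly R}, forall x, `|x| <= a -> `|cos x - p.[x]| <= e.
Proof.
apply: (@exp_dominated_approx (fun n => (~~ odd n)%:R * (-1) ^+ n./2 * (n`!%:R)^-1)).
  move=> n; rewrite !normrM normrX normrN1 expr1n mulr1 ger0_norm//.
  rewrite normfV ger0_norm// ler_piMl//; by case: (~~ _).
move=> x; have <- := cos_coeffE x.
by rewrite unlock; exact: is_cvg_series_cos_coeff.
Qed.

Lemma sin_approx (a e : R) : 0 < e ->
  exists p : {poly R}, forall x, `|x| <= a -> `|sin x - p.[x]| <= e.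
Proof.
apply: (@exp_dominated_approx (fun n => (odd n)%:R * (-1) ^+ n.-1./2 * (n`!%:R)^-1)).
  move=> n; rewrite !normrM normrX normrN1 expr1n mulr1 ger0_norm//.
  rewrite normfV ger0_norm// ler_piMl//; by case: (odd _).
move=> x; have <- := sin_coeffE x.
by rewrite unlock; exact: is_cvg_series_sin_coeff.
Qed.

End cosine_sums.

(** * Equidistribution for rationally independent frequencies *)

Section equidistribution.
Context (R : realType).

Lemma bm_cos_scaled_cos (s : R) : bounded_measurable (fun u => cos (s * cos u)).
Proof.
apply: bm_cos; apply: measurable_funM => //.
by apply: continuous_measurable_fun; exact: continuous_cos.
Qed.

Lemma bm_sin_scaled_cos (s : R) : bounded_measurable (fun u => sin (s * cos u)).
Proof.
apply: bm_sin; apply: measurable_funM => //.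
by apply: continuous_measurable_fun; exact: continuous_cos.
Qed.

Lemma besselJ0E (s : R) : besselJ0 s =
  period_average (fun u => cos (s * cos u)) +i* period_average (fun u => sin (s * cos u)).
Proof. by rewrite /besselJ0 /cintegral /period_average /expi; simpc. Qed.

Lemma scaled_cos_le (s u : R) : `|s * cos u| <= `|s|.
Proof. by rewrite normrM ler_piMr// ler_norml cos_geN1 cos_le1. Qed.

(** Substituting [s * cos u] in the Taylor polynomials of [f] gives polynomials in
    [cos u], that is, cosine sums. *)
Lemma cosine_sum_approx (f : R -> R) (s e : R) :
  (forall a e : R, 0 < e ->
     exists p : {poly R}, forall x, `|x| <= a -> `|f x - p.[x]| <= e) ->
  0 < e -> exists L, forall u, `|f (s * cos u) - cosine_sum L u| <= e.
Proof.
move=> fa e0; have [p pf] := fa `|s| e e0.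
have [L pL] := cosine_sum_horner (p \Po (s *: 'X)).
exists L => u; rewrite pL horner_comp hornerZ hornerX.
exact/pf/scaled_cos_le.
Qed.

(** The angle [th + t * z] is added to those on which [beta] depends.  As none of its
    harmonics resonates with [beta], multiplying by a function of this angle
    multiplies mean values by the period average of the function.  The constant
    [om] lets statements on cosines cover sines as well, by [om - pi / 2]. *)
Section one_phase.
Variables (th z : R) (beta c : R -> R).
Hypothesis mbeta : measurable_fun [set: R] beta.
Hypothesis mean_beta : forall om, mean_value (fun t => cos (beta t + om)) (c om).
Hypothesis mean_char : forall l : int, l != 0 -> forall om,
  mean_value (fun t => cos (beta t + l%:~R * (th + t * z) + om)) 0.

Let bm_beta om : bounded_measurable (fun t => cos (beta t + om)).
Proof. by apply: bm_cos; apply: measurable_funD. Qed.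

Let mphase : measurable_fun [set: R] (fun t => th + t * z).
Proof. by apply: measurable_funD => //; apply: measurable_funM. Qed.

Let bm_char (l : int) om :
  bounded_measurable (fun t => cos (beta t + l%:~R * (th + t * z) + om)).
Proof.
apply: bm_cos; apply: measurable_funD => //; apply: measurable_funD => //.
exact: measurable_funM.
Qed.

Lemma mean_cosine_sum L om :
  mean_value (fun t => cosine_sum L (th + t * z) * cos (beta t + om))
    (period_average (cosine_sum L) * c om).
Proof.
elim: L => [|[r l] L IH].
  rewrite (_ : cosine_sum [::] = fun=> 0); last first.
    by apply/funext => u; rewrite /cosine_sum big_nil.
  rewrite period_average_cst mul0r; under eq_fun do rewrite mul0r.
  exact: mean_value_cst.
have E u : cosine_sum ((r, l) :: L) u = r * cos (l%:~R * u) + 1 * cosine_sum L u.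
  by rewrite /cosine_sum big_cons mul1r.
rewrite (_ : period_average _ * _ =
    r * ((l == 0)%:R * c om) + 1 * (period_average (cosine_sum L) * c om)); last first.
  under [cosine_sum _]funext do rewrite E.
  rewrite period_average_lin ?period_average_cos; first by ring.
    exact/bm_cos/measurable_funM.
  exact: bm_cosine_sum.
rewrite (_ : (fun t => _) = fun t =>
    r * (cos (l%:~R * (th + t * z)) * cos (beta t + om)) +
    1 * (cosine_sum L (th + t * z) * cos (beta t + om))); last first.
  by apply/funext => t; rewrite E; ring.
apply: mean_value_lin => //.
- by apply: bmM => //; apply: bm_cos; exact: measurable_funM.
- by apply: bmM => //; exact: bm_cosine_sum.
rewrite (_ : (fun t => _) = fun t =>
    2^-1 * cos (beta t + l%:~R * (th + t * z) + om) +
    2^-1 * cos (beta t + (- l)%:~R * (th + t * z) + om)); last first.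
  apply/funext => t; rewrite mulrNz mulNr.
  rewrite [beta t + _ * _ + om]addrAC [beta t - _ + om]addrAC.
  by move: (beta t + om) (_ * (th + _)) => v u; rewrite cosD cosB; field.
have [->|l0] := eqVneq l 0.
  rewrite (_ : _ * c om = 2^-1 * c om + 2^-1 * c om); last by rewrite mul1r; field.
  have m0 : mean_value (fun t => cos (beta t + 0%:~R * (th + t * z) + om)) (c om).
    by have := @mean_beta om; congr mean_value; apply/funext => t; rewrite mul0r addr0.
  by apply: mean_value_lin; rewrite ?oppr0.
rewrite (_ : _ * c om = 2^-1 * 0 + 2^-1 * 0); last by rewrite mul0r; ring.
by apply: mean_value_lin; try exact: bm_char; apply: mean_char; rewrite ?oppr_eq0.
Qed.

Lemma mean_approximable (p : R -> R) om : bounded_measurable p ->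
  (forall e, 0 < e -> exists L, forall u, `|p u - cosine_sum L u| <= e) ->
  mean_value (fun t => p (th + t * z) * cos (beta t + om)) (period_average p * c om).
Proof.
move=> bp papprox; apply: mean_value_uniform.
  apply: bmM => //; case: bp => mp [M pM]; split; last by exists M.
  exact: (measurableT_comp mp mphase).
move=> e e0; have d0 : 0 < 1 + `|c om| by rewrite ltr_pwDl.
have [L pL] := papprox (e / (1 + `|c om|)) (divr_gt0 e0 d0).
have ed : e / (1 + `|c om|) <= e.
  by rewrite ler_pdivrMr// ler_peMr ?(ltW e0)// lerDl.
exists (fun t => cosine_sum L (th + t * z) * cos (beta t + om)),
  (period_average (cosine_sum L) * c om); split.
- by apply: bmM => //; exact: bm_cosine_sum.
- exact: mean_cosine_sum.
- rewrite -mulrBl normrM distrC.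
  apply: le_trans (_ : e / (1 + `|c om|) * `|c om| <= _).
    by rewrite ler_wpM2r// period_average_near//; exact: bm_cosine_sum.
  by rewrite mulrAC ler_pdivrMr// ler_wpM2l ?(ltW e0)// lerDr.
- move=> t; rewrite -mulrBl normrM; apply: le_trans ed.
  by rewrite -[leRHS]mulr1 ler_pM// ler_norml cos_geN1 cos_le1.
Qed.

(** Of the expansion of [cos (s * cos u)] and [sin (s * cos u)] in harmonics of the
    new angle, only the constant terms survive in the mean: the two parts of
    [besselJ0 s]. *)
Lemma mean_phase_modulated (s om : R) :
  mean_value (fun t => cos (beta t + s * cos (th + t * z) + om))
    (complex.Re (besselJ0 s) * c om - complex.Im (besselJ0 s) * c (om - pi / 2)).
Proof.
rewrite besselJ0E/=.
have ac := @mean_approximable _ om (bm_cos_scaled_cos s)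
  (fun e => @cosine_sum_approx (@cos R) s e (@cos_approx R)).
have as_ := @mean_approximable _ (om - pi / 2) (bm_sin_scaled_cos s)
  (fun e => @cosine_sum_approx (@sin R) s e (@sin_approx R)).
rewrite (_ : (fun t => _) = fun t =>
    1 * (cos (s * cos (th + t * z)) * cos (beta t + om)) +
    (-1) * (sin (s * cos (th + t * z)) * cos (beta t + (om - pi / 2)))); last first.
  apply/funext => t; rewrite addrAC addrA.
  move: (s * _) (beta t + om) => u v; rewrite cosD cosB cos_pihalf sin_pihalf.
  by ring.
set p := period_average _ * _ in ac *; set q := period_average _ * _ in as_ *.
have -> : p - q = 1 * p + (- 1) * q by ring.
have mc : measurable_fun [set: R] (fun t => s * cos (th + t * z)).
  apply: measurable_funM => //; apply: measurableT_comp mphase.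
  by apply: continuous_measurable_fun; exact: continuous_cos.
apply: mean_value_lin => //; apply: bmM => //; [exact: bm_cos|exact: bm_sin].
Qed.

End one_phase.

Definition phase_sum (a th z : nat -> R) (n : nat) (t : R) : R :=
  \sum_(k < n) a k * cos (th k + t * z k).

(** The coefficients are a finite list, padded with zeros, so that this is a
    conjunction of countably many conditions. *)
Definition rationally_independent (z : nat -> R) : Prop :=
  forall n (js : seq int), js`_n != 0 -> \sum_(k < n.+1) (js`_k)%:~R * z k != 0.

Lemma measurable_phase_sum (a th z : nat -> R) (n : nat) :
  measurable_fun [set: R] (phase_sum a th z n).
Proof.
apply: measurable_sum => k; apply: measurable_funM => //.
apply: measurableT_comp.
  by apply: continuous_measurable_fun; exact: continuous_cos.
by apply: measurable_funD => //; exact: measurable_funM.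
Qed.

(** Harmonics of the last angle change the frequency [xi] of an additional linear
    phase, which is why the induction carries [xi]: either it vanishes, or it is
    not an integral combination of the frequencies. *)
Lemma mean_phase_sum (a th z : nat -> R) : rationally_independent z -> forall n xi om,
  (xi = 0 -> mean_value (fun t => cos (xi * t + phase_sum a th z n t + om))
     (complex.Re (expi om * \prod_(k < n) besselJ0 (a k)))) /\
  ((forall js : seq int, xi + \sum_(k < n) (js`_k)%:~R * z k != 0) ->
     mean_value (fun t => cos (xi * t + phase_sum a th z n t + om)) 0).
Proof.
move=> zfree; elim => [|n IH] xi om.
  split => [->|xiz].
    rewrite big_ord0 mulr1 /=; under eq_fun do rewrite /phase_sum big_ord0 mul0r !add0r.
    exact: mean_value_cst.
  under eq_fun do rewrite /phase_sum big_ord0 addr0.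
  by apply: mean_value_cos; have := xiz [::]; rewrite big_ord0 addr0.
have mb : measurable_fun [set: R] (fun t => xi * t + phase_sum a th z n t).
  by apply: measurable_funD; [exact: measurable_funM|exact: measurable_phase_sum].
have E : (fun t => cos (xi * t + phase_sum a th z n.+1 t + om)) =
   fun t => cos (xi * t + phase_sum a th z n t + a n * cos (th n + t * z n) + om).
  by apply/funext => t; rewrite /phase_sum big_ord_recr/= addrA.
have char (l : int) om' : (forall js : seq int,
      xi + l%:~R * z n + \sum_(k < n) (js`_k)%:~R * z k != 0) ->
    mean_value (fun t => cos (xi * t + phase_sum a th z n t +
      l%:~R * (th n + t * z n) + om')) 0.
  move=> free; have [_ /(_ free)] := IH (xi + l%:~R * z n) (l%:~R * th n + om').
  by congr mean_value; apply/funext => t; congr cos; ring.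
(* Appending the coefficient [l] of [z n] to those of the previous frequencies. *)
have set_sum (js : seq int) (l : int) :
    \sum_(k < n.+1) ((set_nth 0 js n l)`_k)%:~R * z k =
    l%:~R * z n + \sum_(k < n) (js`_k)%:~R * z k.
  rewrite big_ord_recr/= nth_set_nth/= eqxx addrC; congr (_ + _).
  by apply: eq_bigr => k _; rewrite nth_set_nth/= ltn_eqF.
rewrite E; split => [xi0|xiz].
  have := @mean_phase_modulated (th n) (z n) _
    (fun om => complex.Re (expi om * \prod_(k < n) besselJ0 (a k))) mb
    (fun om => (IH xi om).1 xi0) _ (a n) om.
  rewrite big_ord_recr/=.
  set w := \prod_(k < n) _; set J := besselJ0 _.
  have -> : complex.Re J * complex.Re (expi om * w) -
      complex.Im J * complex.Re (expi (om - pi / 2) * w) =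
      complex.Re (expi om * (w * J)).
    rewrite /expi cosB sinB cos_pihalf sin_pihalf.
    by case: w => w1 w2; case: J => j1 j2; simpc => /=; ring.
  apply => l l0 om'; apply: char => js; rewrite xi0 add0r -set_sum.
  by apply: zfree; rewrite nth_set_nth/= eqxx.
have := @mean_phase_modulated (th n) (z n) _ (fun=> 0) mb _ _ (a n) om.
rewrite !mulr0 subr0; apply.
  move=> om'; apply: (IH xi om').2 => js; have := xiz (set_nth 0 js n 0).
  by rewrite set_sum mul0r add0r.
move=> l l0 om'; apply: char => js; rewrite -addrA -set_sum; exact: xiz.
Qed.

Lemma equidistribution (a th z : nat -> R) (n : nat) : rationally_independent z ->
  mean_value (fun t => cos (phase_sum a th z n t))
    (complex.Re (\prod_(k < n) besselJ0 (a k))) /\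
  mean_value (fun t => sin (phase_sum a th z n t))
    (complex.Im (\prod_(k < n) besselJ0 (a k))).
Proof.
move=> zfree; split.
  have := (mean_phase_sum a th zfree n 0 0).1 erefl.
  rewrite /expi cos0 sin0 (_ : 1 +i* 0 = 1)// mul1r.
  by congr mean_value; apply/funext => t; rewrite mul0r add0r addr0.
have := (mean_phase_sum a th zfree n 0 (- (pi / 2))).1 erefl.
rewrite /expi cosN sinN cos_pihalf sin_pihalf.
congr mean_value; last by case: (\prod_(k < n) _) => x y; simpc.
by apply/funext => t; rewrite mul0r add0r cosB cos_pihalf sin_pihalf mulr0 add0r mulr1.
Qed.

End equidistribution.

(** * The maximal inequality *)

Section maximal_sums.
Context (R : realType).
Implicit Types (x : nat -> R) (a : R).

Definition max_sum a L x : R := \big[Num.max/0]_(K < L.+1) \sum_(i < K) (x i - a).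

Lemma max_sum_ge0 a L x : 0 <= max_sum a L x.
Proof. exact: bigmax_ge_id. Qed.

(** The partial sums of [x] are those of its shift, plus the first term: this is
    the pointwise inequality whose integral is the maximal inequality. *)
Lemma max_sum_shift a L x : 0 <= a -> 0 <= x 0%N ->
  max_sum a L x + a * (0 < max_sum a L x)%R%:R <=
  max_sum a L (fun i => x i.+1) + x 0%N.
Proof.
move=> a0 x0; set M' := max_sum a L (fun i => x i.+1).
have M'0 : 0 <= M' by exact: max_sum_ge0.
have MB : max_sum a L x <= Num.max (M' + x 0%N - a) 0.
  apply: bigmax_le => [|[[|K] KL] _ /=]; first by rewrite le_max lexx orbT.
    by rewrite big_ord0 le_max lexx orbT.
  rewrite big_ord_recl le_max addrC addrA lerD2r lerD2r.
  apply/orP; left; have KL' : (K < L.+1)%N by exact: ltnW.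
  exact: (le_bigmax _ (fun K : 'I_L.+1 => \sum_(i < K) (x i.+1 - a)) (Ordinal KL')).
case: ltP => M0; last by rewrite mulr0 addr0 (le_trans M0)// addr_ge0.
rewrite mulr1 -lerBrDr; move: MB; rewrite le_max => /orP[//|].
by rewrite leNgt M0.
Qed.

Lemma max_sum_le a L x : 0 <= a -> (forall i, 0 <= x i <= 1) ->
  max_sum a L x <= L%:R.
Proof.
move=> a0 x01; apply: bigmax_le => [//|[K KL] _ /=].
apply: le_trans (_ : \sum_(i < K) 1 <= _).
  apply: ler_sum => i _; have /andP[_ x1] := x01 i.
  by rewrite lerBlDr (le_trans x1)// lerDl.
by rewrite sumr_const card_ord ler_nat.
Qed.

Lemma le_max_sum a L L' x y : (L <= L')%N -> (forall i, x i <= y i) ->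
  max_sum a L x <= max_sum a L' y.
Proof.
move=> LL' xy; apply: bigmax_le => [|[K KL] _ /=]; first exact: max_sum_ge0.
have KL' : (K < L'.+1)%N by exact: leq_trans KL _.
apply: le_trans (_ : \sum_(i < K) (y i - a) <= _).
  by apply: ler_sum => i _; rewrite lerD2r.
exact: (le_bigmax _ (fun K : 'I_L'.+1 => \sum_(i < K) (y i - a)) (Ordinal KL')).
Qed.

Lemma measurable_bigmax d (E : measurableType d) (I : Type) (s : seq I)
    (f : I -> E -> R) : (forall i, measurable_fun setT (f i)) ->
  measurable_fun setT (fun e => \big[Num.max/0]_(i <- s) f i e).
Proof.
move=> mf; elim: s => [|i s IH].
  by under eq_fun do rewrite big_nil; exact: measurable_cst.
by under eq_fun do rewrite big_cons; exact: measurable_maxr.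
Qed.

Lemma measurable_max_sum d (E : measurableType d) a L (x : nat -> E -> R) :
  (forall i, measurable_fun setT (x i)) ->
  measurable_fun setT (fun e => max_sum a L (x ^~ e)).
Proof.
move=> mx; apply: measurable_bigmax => K; apply: measurable_sum => i.
exact: measurable_funB.
Qed.

(** The maximal ergodic inequality, by Garsia's argument.  Stationarity enters only
    through the means of one functional, the maximum of the partial sums. *)
Lemma garsia d (T : measurableType d) (P : probability T R) a L (x : nat -> T -> R) :
  0 <= a -> (forall i, measurable_fun setT (x i)) -> (forall i w, 0 <= x i w <= 1) ->
  (\int[P]_w (max_sum a L (fun i => x i.+1 w))%:E =
   \int[P]_w (max_sum a L (x ^~ w))%:E)%E ->
  (a%:E * P [set w | (0 < max_sum a L (x ^~ w))%R] <= \int[P]_w (x 0%N w)%:E)%E.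
Proof.
move=> a0 mx x01 EM.
have mM := measurable_max_sum a L mx.
have mM' : measurable_fun setT (fun w => max_sum a L (fun i => x i.+1 w)).
  by apply: measurable_max_sum => i; exact: mx.
set A := [set w | _].
have mA : measurable A.
  rewrite (_ : A = [set: T] `&` (fun w => max_sum a L (x ^~ w)) @^-1` `]0, +oo[%classic).
    by apply: mM => //; exact: measurable_itv.
  by rewrite setTI; apply/seteqP; split => w /=; rewrite in_itv/= andbT.
have xge0 i w : 0 <= x i w by have /andP[] := x01 i w.
have finM : (\int[P]_w (max_sum a L (x ^~ w))%:E)%E \is a fin_num.
  rewrite ge0_fin_numE; last by apply: integral_ge0 => w _; rewrite lee_fin max_sum_ge0.
  apply: le_lt_trans (_ : \int[P]_w (cst L%:R%:E w) < _)%E.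
    apply: ge0_le_integral => //.
    - by move=> w _; rewrite lee_fin max_sum_ge0.
    - exact/measurable_EFinP.
    - by move=> w _ /=; rewrite lee_fin max_sum_le.
  by rewrite integral_cst// lte_mul_pinfty// ltey_eq fin_num_measure.
rewrite -(@leeD2lE _ _ _ _ finM).
have -> : (a%:E * P A = \int[P]_w (a * \1_A w)%:E)%E.
  under eq_integral do rewrite EFinM.
  rewrite ge0_integralZl//; last exact/measurable_EFinP/measurable_indic.
  by rewrite integral_indic// setIT.
rewrite -ge0_integralD//; last 4 first.
- by move=> w _; rewrite lee_fin max_sum_ge0.
- exact/measurable_EFinP.
- by move=> w _; rewrite lee_fin mulr_ge0.
- by apply/measurable_EFinP; apply: measurable_funM => //; exact: measurable_indic.
rewrite -EM -ge0_integralD//; last 4 first.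
- by move=> w _; rewrite lee_fin max_sum_ge0.
- exact/measurable_EFinP.
- by move=> w _; rewrite lee_fin.
- exact/measurable_EFinP.
apply: ge0_le_integral => //.
- by move=> w _; rewrite -EFinD lee_fin addr_ge0 ?max_sum_ge0// mulr_ge0.
- apply: emeasurable_funD; first exact/measurable_EFinP.
  by apply/measurable_EFinP; apply: measurable_funM => //; exact: measurable_indic.
- by apply: emeasurable_funD; exact/measurable_EFinP.
move=> w _; rewrite -!EFinD lee_fin.
rewrite (_ : \1_A w = (0 < max_sum a L (x ^~ w))%R%:R).
  exact: (max_sum_shift L a0 (xge0 0%N w)).
rewrite indicE (_ : (w \in A) = (0 < max_sum a L (x ^~ w))%R)//.
by apply/idP/idP; rewrite inE.
Qed.

End maximal_sums.

(** * Oscillation of the partial sums *)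

Section oscillation.
Context (R : realType).
Implicit Types (r z th : nat -> R) (n N : nat) (t : R).

(** The truncation makes it integrable whatever the amplitudes are; the bound [N]
    makes it depend on finitely many phases, as [phase_shift] requires. *)
Definition oscillation n N r z th t : R :=
  \big[Num.max/0]_(n <= m < N)
    Num.min 1 `|phase_sum r th z m t - phase_sum r th z n t|.

Lemma oscillation_ge0 n N r z th t : 0 <= oscillation n N r z th t.
Proof. exact: bigmax_ge_id. Qed.

Lemma oscillation_le1 n N r z th t : oscillation n N r z th t <= 1.
Proof.
rewrite /oscillation; elim: (index_iota n N) => [|m s IH]; first by rewrite big_nil.
by rewrite big_cons ge_max IH andbT ge_min lexx.
Qed.

Lemma le_oscillation n N m r z th t : (n <= m < N)%N ->
  Num.min 1 `|phase_sum r th z m t - phase_sum r th z n t| <= oscillation n N r z th t.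
Proof.
move=> nmN; pose f m := Num.min 1 `|phase_sum r th z m t - phase_sum r th z n t|.
rewrite -/(f m) /oscillation -/f; apply: (@bigmax_sup_seq _ _ _ _ _ m) => //.
by rewrite mem_index_iota.
Qed.

Lemma oscillation_ext n N r z th th' t : (forall j, (j < N)%N -> th j = th' j) ->
  oscillation n N r z th t = oscillation n N r z th' t.
Proof.
move=> thE; apply: eq_big_nat => m /andP[nm mN].
have sumE k : (k < N)%N -> phase_sum r th z k t = phase_sum r th' z k t.
  move=> kN; apply: eq_bigr => i _; rewrite thE//.
  exact: ltn_trans (ltn_ord i) kN.
by rewrite !sumE// (leq_ltn_trans nm).
Qed.

Lemma oscillation_cos n N r z th th' t t' :
  (forall j, cos (th j + t * z j) = cos (th' j + t' * z j)) ->
  oscillation n N r z th t = oscillation n N r z th' t'.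
Proof.
move=> thE; have sumE k : phase_sum r th z k t = phase_sum r th' z k t'.
  by apply: eq_bigr => i _; rewrite thE.
by rewrite /oscillation; apply: eq_bigr => m _; rewrite !sumE.
Qed.

Lemma measurable_phase_sum_param d (E : measurableType d) (r z th : nat -> E -> R)
    (t : E -> R) n :
  (forall k, measurable_fun setT (r k)) -> (forall k, measurable_fun setT (z k)) ->
  (forall k, measurable_fun setT (th k)) -> measurable_fun setT t ->
  measurable_fun setT (fun e => phase_sum (r ^~ e) (th ^~ e) (z ^~ e) n (t e)).
Proof.
move=> mr mz mth mt; apply: measurable_sum => k; apply: measurable_funM => //.
apply: (measurableT_comp (f := cos)).
  by apply: continuous_measurable_fun; exact: continuous_cos.
by apply: measurable_funD => //; exact: measurable_funM.
Qed.

Lemma measurable_oscillation d (E : measurableType d) (r z th : nat -> E -> R)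
    (t : E -> R) n N :
  (forall k, measurable_fun setT (r k)) -> (forall k, measurable_fun setT (z k)) ->
  (forall k, measurable_fun setT (th k)) -> measurable_fun setT t ->
  measurable_fun setT (fun e => oscillation n N (r ^~ e) (z ^~ e) (th ^~ e) (t e)).
Proof.
move=> mr mz mth mt; apply: measurable_bigmax => m.
apply: measurable_minr; first exact: measurable_cst.
apply: (measurableT_comp (@normr_measurable R setT)).
by apply: measurable_funB; exact: measurable_phase_sum_param.
Qed.

Definition unit_prob : probability (measurableTypeR R) R := uniform_prob (@ltr01 R).

Definition mean_oscillation n N r z th : R :=
  Rintegral unit_prob [set: R] (oscillation n N r z th).

Lemma measurable_oscillation_time n N r z th :
  measurable_fun [set: R] (oscillation n N r z th).
Proof.
by apply: (@measurable_oscillation _ R (fun k _ => r k) (fun k _ => z k) (fun k _ => th k) id).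
Qed.

Lemma mean_oscillation01 n N r z th : 0 <= mean_oscillation n N r z th <= 1.
Proof.
apply/andP; split; first by apply: Rintegral_ge0 => t _; exact: oscillation_ge0.
have -> : 1 = Rintegral unit_prob [set: R] (cst 1).
  by rewrite Rintegral_cst// [X in fine X](_ : _ = 1%E) ?mulr1//; exact: probability_setT.
apply: le_Rintegral => //.
- apply: (@bounded_measurable_integrable _ _ _ _ _ _ 1) => //.
  + by rewrite ltey_eq fin_num_measure.
  + exact: measurable_oscillation_time.
  + by move=> t; rewrite ger0_norm ?oscillation_ge0// oscillation_le1.
- apply: (@bounded_measurable_integrable _ _ _ _ _ _ 1) => //.
  + by rewrite ltey_eq fin_num_measure.
  + by move=> t; rewrite normr1.
- by move=> t _; exact: oscillation_le1.
Qed.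

Lemma EFin_mean_oscillation n N r z th : (mean_oscillation n N r z th)%:E =
  (\int[unit_prob]_t (oscillation n N r z th t)%:E)%E.
Proof.
rewrite /mean_oscillation /Rintegral fineK//.
apply: integrable_fin_num => //.
apply: (@bounded_measurable_integrable _ _ _ _ _ _ 1) => //.
- by rewrite ltey_eq fin_num_measure.
- exact: measurable_oscillation_time.
- by move=> t; rewrite ger0_norm ?oscillation_ge0// oscillation_le1.
Qed.

Lemma measurable_mean_oscillation d (E : measurableType d) (r z th : nat -> E -> R) n N :
  (forall k, measurable_fun setT (r k)) -> (forall k, measurable_fun setT (z k)) ->
  (forall k, measurable_fun setT (th k)) ->
  measurable_fun setT (fun e => mean_oscillation n N (r ^~ e) (z ^~ e) (th ^~ e)).
Proof.
move=> mr mz mth; apply/measurable_EFinP.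
rewrite (_ : EFin \o _ = fun e => \int[unit_prob]_t
    (oscillation n N (r ^~ e) (z ^~ e) (th ^~ e) t)%:E)%E; last first.
  by apply/funext => e; exact: EFin_mean_oscillation.
apply: (measurable_fun_fubini_tonelli_F (m2 := unit_prob)
  (fun x : E * measurableTypeR R =>
     (oscillation n N (r ^~ x.1) (z ^~ x.1) (th ^~ x.1) x.2)%:E)).
- apply/measurable_EFinP.
  apply: (@measurable_oscillation _ (E * measurableTypeR R)%type (fun k x => r k x.1)
    (fun k x => z k x.1) (fun k x => th k x.1) snd) => // k;
  by apply: (measurableT_comp _ measurable_fst).
- by move=> x; rewrite lee_fin oscillation_ge0.
Qed.

End oscillation.

Section maximal_oscillation.
Context d (T : measurableType d) (R : realType) (P : probability T R).
Variables (F : set_system T) (Y : nat -> {RV P >-> R}) (r z : nat -> T -> R).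
Hypotheses (FI : setI_closed F) (FT : F [set: T]) (Fm : F `<=` measurable).
Hypothesis indepY : independent_RVs P (fun j => Y j : T -> R).
Hypothesis indepFY : independent2 P F (sigma_gen (fun j => Y j : T -> R)).
Hypothesis unifY : forall k, has_law (Y k) (uniform_prob (twopi_gt0 R)).
Hypothesis rF : forall k (B : set R), measurable B -> F (r k @^-1` B).
Hypothesis zF : forall k (B : set R), measurable B -> F (z k @^-1` B).

Let mF (f : T -> R) : (forall B : set R, measurable B -> F (f @^-1` B)) ->
  measurable_fun setT f.
Proof. by move=> fF _ B mB; rewrite setTI; exact/Fm/fF. Qed.

(** The phases at time [i] are [Y k + i * z k]; moving on by one unit of time
    leaves their joint law with amplitudes and frequencies unchanged. *)
Lemma maximal_oscillation n N L (a : R) : 0 <= a ->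
  (a%:E * P [set w | (0 < max_sum a L (fun i =>
     mean_oscillation n N (r ^~ w) (z ^~ w) (fun k => Y k w + i%:R * z k w)))%R] <=
   \int[P]_w (mean_oscillation n N (r ^~ w) (z ^~ w) (Y ^~ w))%:E)%E.
Proof.
move=> a0.
pose x i w := mean_oscillation n N (r ^~ w) (z ^~ w) (fun k => Y k w + i%:R * z k w).
have mr k : measurable_fun setT (r k) by exact: mF (rF k).
have mz k : measurable_fun setT (z k) by exact: mF (zF k).
have -> : (\int[P]_w (mean_oscillation n N (r ^~ w) (z ^~ w) (Y ^~ w))%:E =
    \int[P]_w (x 0%N w)%:E)%E.
  apply: eq_integral => w _; rewrite /x; congr (mean_oscillation _ _ _ _ _)%:E.
  by apply/funext => k; rewrite mul0r addr0.
apply: (@garsia _ _ _ P a L x a0).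
- move=> i; apply: measurable_mean_oscillation => // k.
  by apply: measurable_funD => //; exact: measurable_funM.
- by move=> i w; exact: mean_oscillation01.
pose phi r z th : \bar R := (max_sum a L (fun i =>
  mean_oscillation n N r z (fun k => th k + i%:R * z k)))%:E.
have := @phase_shift _ _ _ P F Y r z z FI FT Fm indepY indepFY unifY rF zF zF N phi.
rewrite /phi => shift; rewrite -[RHS]shift.
- apply: eq_integral => w _; congr (max_sum _ _ _)%:E; apply/funext => i.
  congr mean_oscillation; apply/funext => k.
  by rewrite -natr1; ring.
- move=> d' E r' z' th' mr' mz' mth'; apply/measurable_EFinP.
  apply: (@measurable_max_sum _ _ E a L (fun i e => mean_oscillation n N (r' ^~ e)
    (z' ^~ e) (fun k => th' k e + i%:R * z' k e))) => i.
  apply: (@measurable_mean_oscillation _ _ E r' z'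
    (fun k e => th' k e + i%:R * z' k e) n N mr' mz') => k.
  by apply: measurable_funD; [exact: mth'|exact: measurable_funM].
- by move=> *; rewrite lee_fin max_sum_ge0.
- move=> r' z' th th' thE; congr (max_sum _ _ _)%:E; apply/funext => i.
  apply: eq_Rintegral => t _; apply: oscillation_ext => j jN.
  by rewrite thE.
- move=> r' z' th k; congr (max_sum _ _ _)%:E; apply/funext => i.
  apply: eq_Rintegral => t _; apply: oscillation_cos => j.
  case: (j == k); last by [].
  rewrite -(cosD2pi (th j + i%:R * z' j + t * z' j)).
  by congr cos; rewrite mulr2n; ring.
Qed.

End maximal_oscillation.

(** * Almost sure control of the remainders *)

Section almost_sure.
Context d (T : measurableType d) (R : realType) (P : probability T R).

Lemma ae_exists_notin (B : nat -> set T) (u : nat -> \bar R) :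
  (forall n, measurable (B n)) -> (forall n, (P (B n) <= u n)%E) ->
  u @ \oo --> 0%E -> {ae P, forall w, exists n, ~ B n w}.
Proof.
move=> mB Bu u0; exists (\bigcap_n B n); split.
- exact: bigcapT_measurable.
- apply/eqP; rewrite -measure_le0; apply: (cvge_to_ge u0).
  apply: nearW => n; apply: le_trans (Bu n); apply: le_measure; rewrite ?inE//.
    exact: bigcapT_measurable.
  exact: bigcap_inf.
- by move=> w /= nB n _; apply: contrapT => Bn; apply: nB; exists n.
Qed.

Lemma markov_ge0 (e : R) (q : T -> R) : 0 < e -> measurable_fun setT q ->
  (forall w, 0 <= q w) ->
  (P [set w | (e <= q w)%R] <= e^-1%:E * \int[P]_w (q w)%:E)%E.
Proof.
move=> e0 mq q0; set B := [set w | _].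
have mB : measurable B.
  rewrite (_ : B = [set: T] `&` q @^-1` `[e, +oo[%classic).
    by apply: mq => //; exact: measurable_itv.
  by rewrite setTI; apply/seteqP; split => w /=; rewrite in_itv/= andbT.
rewrite lee_pdivlMl//.
have -> : (P B = \int[P]_w (\1_B w)%:E)%E by rewrite integral_indic// setIT.
rewrite -ge0_integralZl//; last 2 first.
- exact/measurable_EFinP/measurable_indic.
- by rewrite lee_fin ltW.
apply: ge0_le_integral => //.
- by move=> w _; rewrite -EFinM lee_fin mulr_ge0// ltW.
- by apply: measurable_funeM; exact/measurable_EFinP/measurable_indic.
- exact/measurable_EFinP.
move=> w _; rewrite -EFinM lee_fin indicE.
by case: (boolP (w \in B)); rewrite ?inE ?mulr1 ?mulr0.
Qed.

Variables (S : nat -> T * R -> R) (X : T * R -> R).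
Hypothesis mS : forall n, measurable_fun setT (S n).
Hypothesis mX : measurable_fun setT X.

Definition trunc_dist (m : nat) (x : T * R) : R := Num.min 1 `|S m x - X x|.

(** Bounds, up to a factor 2, the oscillation of [S] after [n], whatever the last
    index; its integrals vanish in the limit by dominated convergence. *)
Definition tail_dist (n : nat) (x : T * R) : R := sups (trunc_dist ^~ x) n.

Lemma trunc_dist01 m x : 0 <= trunc_dist m x <= 1.
Proof. by rewrite /trunc_dist le_min ler01 normr_ge0/= ge_min lexx. Qed.

Lemma trunc_dist_ub x : has_ubound (range (trunc_dist ^~ x)).
Proof. by exists 1 => _ [m _ <-]; have /andP[] := trunc_dist01 m x. Qed.

Lemma le_tail_dist n m x : (n <= m)%N -> trunc_dist m x <= tail_dist n x.
Proof.
move=> nm; apply: ub_le_sup; last by exists m.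
exact/has_ubound_sdrop/trunc_dist_ub.
Qed.

Lemma tail_dist_le n x (e : R) :
  (forall m, (n <= m)%N -> trunc_dist m x <= e) -> tail_dist n x <= e.
Proof.
move=> h; apply: ge_sup; first by exists (trunc_dist n x), n => /=.
by move=> _ [m /= nm <-]; exact: h.
Qed.

Lemma tail_dist01 n x : 0 <= tail_dist n x <= 1.
Proof.
apply/andP; split.
  by apply: le_trans (le_tail_dist _ (leqnn n)); have /andP[] := trunc_dist01 n x.
by apply: tail_dist_le => m _; have /andP[] := trunc_dist01 m x.
Qed.

Lemma measurable_trunc_dist m : measurable_fun setT (trunc_dist m).
Proof.
apply: measurable_minr => //; apply: (measurableT_comp (@normr_measurable R setT)).
exact: measurable_funB.
Qed.

Lemma measurable_tail_dist n : measurable_fun setT (tail_dist n).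
Proof.
by apply: measurable_fun_sups => [x _|m]; [exact: trunc_dist_ub|exact: measurable_trunc_dist].
Qed.

Lemma cvg_tail_dist x : S ^~ x @ \oo --> X x -> tail_dist ^~ x @ \oo --> 0.
Proof.
move=> SX; apply/cvgrPdist_le => e e0.
have [N _ SN] : \forall n \near \oo, `|X x - S n x| <= e.
  by move/cvgrPdist_le : SX; exact.
exists N => // n /= Nn; rewrite sub0r normrN ger0_norm; last first.
  by have /andP[] := tail_dist01 n x.
apply: tail_dist_le => m nm; rewrite /trunc_dist ge_min distrC.
by apply/orP; right; apply: SN; exact: leq_trans nm.
Qed.

Hypothesis SX : forall t, {ae P, forall w, S ^~ (w, t) @ \oo --> X (w, t)}.

Variable nu : probability (measurableTypeR R) R.

Definition mean_tail (n : nat) (w : T) : R :=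
  Rintegral nu [set: R] (fun t => tail_dist n (w, t)).

Let mtd_t n w : measurable_fun [set: measurableTypeR R] (fun t => tail_dist n (w, t)).
Proof. exact: (measurableT_comp (measurable_tail_dist n) (pair1_measurable w)). Qed.

Let mtd_w n t : measurable_fun [set: T] (fun w => tail_dist n (w, t)).
Proof. exact: (measurableT_comp (measurable_tail_dist n) (pair2_measurable t)). Qed.

Lemma integrable_tail n w : nu.-integrable [set: R] (fun t => (tail_dist n (w, t))%:E).
Proof.
apply: (@bounded_measurable_integrable _ _ _ _ _ _ 1) => //.
  by rewrite ltey_eq fin_num_measure.
by move=> t; rewrite ger0_norm; have /andP[] := tail_dist01 n (w, t).
Qed.

Lemma EFin_mean_tail n w :
  (mean_tail n w)%:E = (\int[nu]_t (tail_dist n (w, t))%:E)%E.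
Proof.
by rewrite /mean_tail /Rintegral fineK//; exact: (integrable_fin_num _ (integrable_tail n w)).
Qed.

Lemma mean_tail_ge0 n w : 0 <= mean_tail n w.
Proof. by apply: Rintegral_ge0 => t _; have /andP[] := tail_dist01 n (w, t). Qed.

Let mtd_pair n :
  measurable_fun [set: T * measurableTypeR R] (fun x => (tail_dist n x)%:E).
Proof. by apply/measurable_EFinP; exact: measurable_tail_dist. Qed.

Lemma measurable_mean_tail n : measurable_fun setT (mean_tail n).
Proof.
apply/measurable_EFinP.
rewrite (_ : EFin \o _ = fun w => \int[nu]_t (tail_dist n (w, t))%:E)%E; last first.
  by apply/funext => w; exact: EFin_mean_tail.
apply: (measurable_fun_fubini_tonelli_F (m2 := nu) _ (mtd_pair n)) => x.
by rewrite lee_fin; have /andP[] := tail_dist01 n x.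
Qed.

(** The integrals are exchanged first: the series converges at each fixed time for
    almost every [w], with an exceptional set that depends on time. *)
Lemma mean_tail_cvg0 : (\int[P]_w (mean_tail n w)%:E)%E @[n --> \oo] --> 0%E.
Proof.
rewrite (_ : (fun n => _) = fun n =>
    (\int[nu]_t \int[P]_w (tail_dist n (w, t))%:E)%E); last first.
  apply/funext => n; under eq_integral do rewrite EFin_mean_tail.
  apply: (@fubini_tonelli _ _ _ _ _ P nu _ (mtd_pair n)) => x.
  by rewrite lee_fin; have /andP[] := tail_dist01 n x.
have inner t : (\int[P]_w (tail_dist n (w, t))%:E)%E @[n --> \oo] --> 0%E.
  have := @dominated_convergence _ _ _ P setT measurableT
    (fun n w => (tail_dist n (w, t))%:E) (cst 0%E) (cst 1%E) _ _ _ _ _.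
  rewrite integral_cst// mul0e; case => //.
  - by move=> n; apply/measurable_EFinP.
  - apply: filterS (SX t) => w Sw _; apply: cvg_EFin; first exact: nearW.
    exact: cvg_tail_dist.
  - apply: (@bounded_measurable_integrable _ _ _ P setT (cst 1) 1) => //.
      by rewrite ltey_eq fin_num_measure.
    by move=> w; rewrite normr1.
  - apply: aeW => w n _ /=; rewrite lee_fin ger0_norm;
    by have /andP[] := tail_dist01 n (w, t).
have := @dominated_convergence _ _ _ nu setT measurableT
  (fun n t => \int[P]_w (tail_dist n (w, t))%:E)%E (cst 0%E) (cst 1%E) _ _ _ _ _.
rewrite integral_cst// mul0e; case => //.
- move=> n; apply: (measurable_fun_fubini_tonelli_G (m1 := P) _ (mtd_pair n)) => x.
  by rewrite lee_fin; have /andP[] := tail_dist01 n x.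
- by apply: aeW => t _; exact: inner.
- apply: (@bounded_measurable_integrable _ _ _ nu setT (cst 1) 1) => //.
    by rewrite ltey_eq fin_num_measure.
  by move=> w; rewrite normr1.
- apply: aeW => t n _; rewrite gee0_abs; last first.
    by apply: integral_ge0 => w _; rewrite lee_fin; have /andP[] := tail_dist01 n (w, t).
  apply: le_trans (_ : \int[P]_w cst 1%E w <= _)%E.
    apply: ge0_le_integral => //.
    + by move=> w _; rewrite lee_fin; have /andP[] := tail_dist01 n (w, t).
    + by apply/measurable_EFinP.
    + by move=> w _; rewrite lee_fin; have /andP[] := tail_dist01 n (w, t).
  by rewrite integral_cst// mul1e /= probability_le1.
Qed.

Lemma ae_mean_tail_small (e : R) : 0 < e ->
  {ae P, forall w, exists n, mean_tail n w < e}.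
Proof.
move=> e0.
have h : {ae P, forall w, exists n, ~ [set w | e <= mean_tail n w] w}.
  apply: (@ae_exists_notin (fun n => [set w | e <= mean_tail n w])
    (fun n => e^-1%:E * \int[P]_w (mean_tail n w)%:E)%E).
  - move=> n; rewrite (_ : [set w | _] = [set: T] `&` mean_tail n @^-1` `[e, +oo[%classic).
      by apply: measurable_mean_tail => //; exact: measurable_itv.
    by rewrite setTI; apply/seteqP; split => w /=; rewrite in_itv/= andbT.
  - move=> n; apply: markov_ge0 => //; [exact: measurable_mean_tail|exact: mean_tail_ge0].
  - by rewrite -[0%E](mule0 e^-1%:E); apply: cvgeM; [|exact: cvg_cst|exact: mean_tail_cvg0].
by apply: filterS h => w [n /negP]; rewrite -ltNge => nw; exists n.
Qed.

End almost_sure.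

(** * From oscillation bounds to time averages *)

Section lipschitz.
Context (R : realType).

Lemma dist_le_derivative (f df : R -> R) : (forall x, is_derive x (1 : R) f (df x)) ->
  (forall x, `|df x| <= 1) -> forall u v, `|f u - f v| <= `|u - v|.
Proof.
move=> fdf df1 u v; wlog uv : u v / u < v.
  move=> h; have [uv|vu|->] := ltgtP u v; [exact: h|by rewrite distrC (distrC u) h|].
  by rewrite !subrr.
have cf : {within `[u, v], continuous f}.
  apply: continuous_subspaceT => x; apply: differentiable_continuous.
  by apply/derivable1_diffP; have [] := fdf x.
have [x _ E] := @MVT R f df u v uv (fun x _ => fdf x) cf.
by rewrite distrC E normrM [leRHS]distrC ler_piMl.
Qed.

Lemma dist_cos (u v : R) : `|cos u - cos v| <= `|u - v|.
Proof.
apply: (@dist_le_derivative _ (fun x => - sin x)) => x.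
by rewrite normrN ler_norml sin_geN1 sin_le1.
Qed.

Lemma dist_sin (u v : R) : `|sin u - sin v| <= `|u - v|.
Proof.
apply: (@dist_le_derivative _ (@cos R)) => x.
by rewrite ler_norml cos_geN1 cos_le1.
Qed.

(** With [c] a cosine or a sine: bounded Lipschitz functions are controlled by the
    truncated distance. *)
Lemma trunc_lipschitz (c : R -> R) (l u v : R) :
  (forall u, `|c u| <= 1) -> (forall u v, `|c u - c v| <= `|u - v|) ->
  `|c (l * u) - c (l * v)| <= (2 + `|l|) * Num.min 1 `|u - v|.
Proof.
move=> c1 cl; case: (leP 1 `|u - v|) => _.
  rewrite mulr1; apply: le_trans (ler_normB _ _) _; apply: le_trans (lerD (c1 _) (c1 _)) _.
  by rewrite -{1}[1 + 1]addr0; apply: lerD => //; rewrite -natrD.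
apply: le_trans (cl _ _) _; rewrite -mulrBr normrM ler_wpM2r//.
by rewrite lerDr.
Qed.

End lipschitz.

Lemma Rintegral_itv_widen (R : realType) (D : R -> R) (A B : R) :
  bounded_measurable D -> (forall t, 0 <= D t) -> A <= B ->
  (\int[@lebesgue_measure R]_(t in `[0%R, A]) D t)%R <=
  (\int[@lebesgue_measure R]_(t in `[0%R, B]) D t)%R.
Proof.
move=> bD D0 AB; have [A0|A0] := leP 0 A; last first.
  rewrite set_itv_ge ?bnd_simp -?ltNge// Rintegral_set0.
  by apply: Rintegral_ge0 => t _; exact: D0.
have BE : `[0, B]%classic = `[0, A]%classic `|` `]A, B]%classic :> set R.
  by rewrite -itv_bndbnd_setU// bnd_simp.
rewrite BE Rintegral_setU//.
- by rewrite lerDl; apply: Rintegral_ge0 => t _; exact: D0.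
- by rewrite -BE; exact: bm_integrable.
- apply/disj_setPS => t [/=]; rewrite !in_itv/= => /andP[_ tA] /andP[At _].
  by move: (lt_le_trans At tA); rewrite ltxx.
Qed.

Section pathwise.
Context (R : realType).
Notation mu := (@lebesgue_measure R).
Variables (g_ : nat -> R -> R) (g : R -> R) (q : nat -> R) (C : R).
Variables (s_ : nat -> R -> R) (x : R -> R).
Hypothesis C0 : 0 < C.
Hypothesis bg_ : forall n, bounded_measurable (g_ n).
Hypothesis bg : bounded_measurable g.
Hypothesis ms_ : forall n, measurable_fun [set: R] (s_ n).
Hypothesis mx : measurable_fun [set: R] x.
Hypothesis mean_g_ : forall n, mean_value (g_ n) (q n).
Hypothesis g_s : forall m n t, `|g_ m t - g_ n t| <= C * Num.min 1 `|s_ m t - s_ n t|.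
Hypothesis g_x : forall m t, `|g t - g_ m t| <= C * Num.min 1 `|s_ m t - x t|.
Hypothesis close_x : forall (K : nat) e, 0 < e -> exists n, forall m, (n <= m)%N ->
  (\int[mu]_(t in `[0%R, K%:R]) Num.min 1 `|s_ m t - x t|)%R <= e.
Hypothesis close_s : forall a, 0 < a -> exists n, forall m (K : nat), (n <= m)%N ->
  (\int[mu]_(t in `[0%R, K%:R]) Num.min 1 `|s_ m t - s_ n t|)%R <= a * K%:R.

Lemma bm_min_dist (u v : R -> R) : measurable_fun [set: R] u -> measurable_fun [set: R] v ->
  bounded_measurable (fun t => Num.min 1 `|u t - v t|).
Proof.
move=> mu_ mv; split.
  apply: measurable_minr => //; apply: (measurableT_comp (@normr_measurable R setT)).
  exact: measurable_funB.
by exists 1 => t; rewrite ger0_norm ?ge_min ?lexx// le_min ler01/=.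
Qed.

Lemma average_close (h k D : R -> R) (A e : R) (K : nat) : 0 < A -> A <= K%:R ->
  bounded_measurable h -> bounded_measurable k -> bounded_measurable D ->
  (forall t, 0 <= D t) ->
  (forall t, `|h t - k t| <= C * D t) ->
  (\int[mu]_(t in `[0%R, K%:R]) D t)%R <= e ->
  `|A^-1 * (\int[mu]_(t in `[0%R, A]) h t)%R - A^-1 * (\int[mu]_(t in `[0%R, A]) k t)%R|
    <= A^-1 * (C * e).
Proof.
move=> A0 AK bh bk bD D0 hkD De.
rewrite -mulrBr normrM gtr0_norm ?invr_gt0// ler_wpM2l ?invr_ge0 ?(ltW A0)//.
rewrite -RintegralB//; [|exact: bm_integrable..].
have bhk : bounded_measurable (fun t => h t - k t).
  have := bmD bh (bmM (bm_cst (-1)) bk).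
  by congr bounded_measurable; apply/funext => t /=; rewrite mulN1r.
apply: le_trans (le_normr_Rintegral _ (bm_integrable 0 A bhk)) _ => //.
have bCD : bounded_measurable (fun t => C * D t) := bmM (bm_cst C) bD.
apply: le_trans (_ : (\int[mu]_(t in `[0%R, A]) (C * D t))%R <= _).
  apply: le_Rintegral => //; last exact: bm_integrable.
  apply: (@bm_integrable R 0 A (fun t => `|h t - k t|)).
  case: bhk => m [M hM]; split; first exact: (measurableT_comp (@normr_measurable R setT)).
  by exists M => t; rewrite normr_id.
rewrite RintegralZl//; last exact: bm_integrable.
rewrite ler_wpM2l ?(ltW C0)//; apply: le_trans De.
exact: Rintegral_itv_widen.
Qed.

Let ceil_bound (A : R) : 0 < A -> exists K : nat, A <= K%:R /\ K%:R <= A + 1.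
Proof.
move=> A0; exists (Num.truncn A).+1; split; first exact/ltW/truncnS_gt.
by rewrite -natr1 lerD2r truncn_le// ltW.
Qed.

Let min_ge0 (u : R) : 0 <= Num.min 1 `|u|.
Proof. by rewrite le_min ler01 normr_ge0. Qed.

(** [close_s] is uniform in the horizon [K]: it makes all time averages of the
    [g_ n] uniformly close, hence [q] a Cauchy sequence.  [close_x] depends on the
    horizon, but it is used for one horizon at a time, to replace the average of
    [g] by that of some [g_ m] of large rank. *)
Lemma mean_value_limit : cvgn q /\ mean_value g (limn q).
Proof.
have avg_s a : 0 < a -> exists n, forall m A, (n <= m)%N -> 1 <= A ->
    `|A^-1 * (\int[mu]_(t in `[0%R, A]) g_ m t)%R -
      A^-1 * (\int[mu]_(t in `[0%R, A]) g_ n t)%R| <= 2 * C * a.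
  move=> a0; have [n sn] := close_s a0; exists n => m A nm A1.
  have A0 : 0 < A by exact: lt_le_trans A1.
  have [K [AK KA]] := ceil_bound A0.
  apply: le_trans (average_close A0 AK (bg_ m) (bg_ n)
    (bm_min_dist (ms_ m) (ms_ n)) _ (g_s m n) (sn m K nm)) _ => //.
  rewrite ler_pdivrMl// (_ : A * _ = C * (a * (2 * A))); last by ring.
  by rewrite !ler_pM2l//; lra.
have q_s a n : (forall m A, (n <= m)%N -> 1 <= A ->
    `|A^-1 * (\int[mu]_(t in `[0%R, A]) g_ m t)%R -
      A^-1 * (\int[mu]_(t in `[0%R, A]) g_ n t)%R| <= 2 * C * a) ->
    forall m, (n <= m)%N -> `|q m - q n| <= 2 * C * a.
  move=> sn m nm.
  apply: (cvgr_to_le (cvg_norm (cvgB (@mean_g_ m) (@mean_g_ n)))).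
  near=> A; apply: sn => //; near: A; exact: nbhs_pinfty_ge.
have cq : cvgn q.
  apply: cauchy_cvg; apply: cauchy_exP => e e0.
  have a0 : 0 < e / (4 * C) by rewrite divr_gt0// mulr_gt0.
  have [n /q_s qn] := avg_s _ a0; exists (q n); exists n => // m /= nm.
  rewrite -ball_normE/= distrC; apply: le_lt_trans (qn m nm) _.
  rewrite (_ : 2 * C * _ = e / 2); last by field; rewrite gt_eqF.
  by rewrite ltr_pdivrMr// ltr_pMr// ltr1n.
split=> //; apply/cvgrPdist_le => e e0.
have a0 : 0 < e / (6 * C) by rewrite divr_gt0// mulr_gt0.
set a := e / (6 * C) in a0.
have aE : C * a = e / 6 by rewrite /a; field; rewrite gt_eqF.
have [n sn] := avg_s a a0.
have qn : `|limn q - q n| <= 2 * C * a.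
  apply: (cvgr_to_le (cvg_norm (cvgB cq (cvg_cst (q n))))).
  by exists n => // m /= nm; exact: (q_s a n sn).
near=> A.
have A1 : 1 <= A by near: A; exact: nbhs_pinfty_ge.
have A0 : 0 < A by exact: lt_le_trans A1.
have gn : `|q n - A^-1 * (\int[mu]_(t in `[0%R, A]) g_ n t)%R| <= C * a.
  near: A; have /cvgrPdist_le := @mean_g_ n; apply.
  by rewrite mulr_gt0.
have [K [AK KA]] := ceil_bound A0.
have [m0 xm] := close_x K a0.
pose m := maxn n m0.
have gm := sn m A (leq_maxl _ _) A1.
have gx := average_close A0 AK bg (bg_ m) (bm_min_dist (ms_ m) mx)
  (fun t => min_ge0 _) (g_x m) (xm m (leq_maxr _ _)).
have {}gx : `|A^-1 * (\int[mu]_(t in `[0%R, A]) g t)%R -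
    A^-1 * (\int[mu]_(t in `[0%R, A]) g_ m t)%R| <= C * a.
  apply: le_trans gx _; rewrite ler_pdivrMl//.
  exact: ler_peMl (ltW (mulr_gt0 C0 a0)) A1.
have CaE : 2 * C * a = e / 3 by rewrite -mulrA aE; field.
rewrite {}CaE in gm qn; rewrite {}aE in gn gx.
have tri (u v y y' y'' : R) : `|u - v| <= e / 3 -> `|v - y| <= e / 6 ->
    `|y' - y| <= e / 3 -> `|y'' - y'| <= e / 6 -> `|u - y''| <= e.
  rewrite !ler_norml => /andP[? ?] /andP[? ?] /andP[? ?] /andP[? ?].
  by apply/andP; split; lra.
exact: tri qn gn gm gx.
Unshelve. all: by end_near. Qed.

End pathwise.

(** * Rational independence of the frequencies *)

Section independent_frequencies.
Context d (T : measurableType d) (R : realType) (P : probability T R).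
Variable Z : nat -> {RV P >-> R}.
Hypothesis indepZ : independent_RVs P (fun j => Z j : T -> R).
Hypothesis diffuseZ : forall k y, P (Z k @^-1` [set y]) = 0%E.

(** Given the other frequencies, [Z n] would have to take one specific value, which
    has probability zero. *)
Lemma ae_lincomb_neq0 n (js : seq int) : js`_n != 0 ->
  {ae P, forall w, \sum_(k < n.+1) (js`_k)%:~R * Z k w != 0}.
Proof.
(* Nothing but the other variables is conditioned upon: [F] is trivial. *)
move=> jn; pose F : set_system T := [set [set: T]].
have FT : F [set: T] by [].
have FI : setI_closed F by move=> _ _ -> ->; rewrite setIT.
have Fm : F `<=` measurable by move=> _ ->.
have indepF : independent2 P F (sigma_gen (fun j => Z j : T -> R)).
  by move=> _ B -> _; rewrite setTI probability_setT mul1e.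
pose O := others F Z n n.
pose g (x : O * R) : R := \sum_(k < n) (js`_k)%:~R * Z k (x.1 : T) + (js`_n)%:~R * x.2.
have mg : measurable_fun [set: O * R] g.
  apply: measurable_funD; last exact: measurable_funM.
  apply: measurable_sum => k; apply: measurable_funM => //.
  apply: (measurableT_comp (f := (Z k : O -> R))) => //.
  by apply: others_rv_measurable => //; rewrite ltn_eqF.
pose B : set (O * R) := g @^-1` [set 0].
have mB : measurable B by rewrite -[B]setTI; exact: mg.
have mh : measurable_fun [set: O * R] (fun x => (\1_B x)%:E : \bar R).
  exact/measurable_EFinP/measurable_indic.
have h0 (x : O * R) : (0 <= (\1_B x)%:E :> \bar R)%E by rewrite lee_fin.
have := others_integral FI FT Fm indepZ indepF mh h0.
pose N : set T := [set w | \sum_(k < n.+1) (js`_k)%:~R * Z k w = 0].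
have mN : measurable N.
  rewrite (_ : N = [set: T] `&` (fun w => \sum_(k < n.+1) (js`_k)%:~R * Z k w) @^-1` [set 0]).
    by apply: measurable_sum => // k; exact: measurable_funM.
  by rewrite setTI.
have -> : (\int[P]_w (\1_B ((w : O), Z n w))%:E = P N)%E.
  transitivity (\int[P]_w (\1_N w)%:E)%E; last by rewrite integral_indic// setIT.
  apply: eq_integral => w _; rewrite !indicE; congr (nat_of_bool _)%:R%:E.
  apply/idP/idP; rewrite !inE /N /B /g/=; by rewrite big_ord_recr.
rewrite (_ : (\int[P]_w _ = 0)%E); last first.
  apply: integral0_eq => w _.
  pose y0 := - (\sum_(k < n) (js`_k)%:~R * Z k w) / (js`_n)%:~R.
  rewrite -[RHS](diffuseZ n y0) -[RHS]/(distribution P (Z n) [set y0]).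
  transitivity (\int[distribution P (Z n)]_y (\1_[set y0] y)%:E)%E; last first.
    by rewrite integral_indic// setIT.
  apply: eq_integral => y _; rewrite !indicE; congr (nat_of_bool _)%:R%:E.
  have jn' : (js`_n)%:~R != 0 :> R by rewrite intr_eq0.
  apply/idP/idP; rewrite !inE /B /g/= /y0.
    by move/eqP; rewrite addr_eq0 => /eqP ->; rewrite opprK mulrC mulKf.
  by move=> ->; rewrite mulrC divfK// addrN.
move=> PN; exists N; split => // w /= /negP; rewrite negbK => /eqP.
by [].
Qed.

Lemma ae_rationally_independent :
  {ae P, forall w, rationally_independent (fun k => Z k w)}.
Proof.
have h (i : nat) : {ae P, forall w, forall nj : nat * seq int, unpickle i = Some nj ->
    nj.2`_nj.1 != 0 -> \sum_(k < nj.1.+1) (nj.2`_k)%:~R * Z k w != 0}.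
  case: (unpickle i) => [[n js]|]; last by apply: aeW.
  have [jn0|jn0] := eqVneq js`_n 0.
    by apply: aeW => w _ [<-]; rewrite jn0 eqxx.
  by apply: filterS (ae_lincomb_neq0 jn0) => w hw _ [<-].
apply: filterS (ae_foralln h) => w hw n js.
exact: (hw (pickle (n, js)) (n, js) (pickleK _)).
Qed.

End independent_frequencies.

(** * Time averages along almost every path *)

Section mean_oscillation_time.
Context (R : realType).
Notation mu := (@lebesgue_measure R).

Lemma Rintegral_itv_prob (K : R) (K0 : 0 < K) (f : R -> R) : bounded_measurable f ->
  (forall t, 0 <= f t) ->
  Rintegral (uniform_prob K0) [set: R] f = K^-1 * (\int[mu]_(t in `[0%R, K]) f t)%R.
Proof.
move=> bf f0; rewrite /Rintegral integral_uniform//; last first.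
  by case: bf => mf _; exact/measurable_EFinP.
by rewrite subr0 fineM//; exact: integrable_fin_num (bm_integrable 0 K bf).
Qed.

Lemma bm_oscillation n N (r z th : nat -> R) : bounded_measurable (oscillation n N r z th).
Proof.
split; first exact: measurable_oscillation_time.
by exists 1 => t; rewrite ger0_norm ?oscillation_ge0// oscillation_le1.
Qed.

(** Turns averages over integer times, to which the maximal inequality applies,
    into averages over intervals. *)
Lemma sum_mean_oscillation n N (r z th : nat -> R) (K : nat) :
  \sum_(i < K) mean_oscillation n N r z (fun k => th k + i%:R * z k) =
  (\int[mu]_(t in `[0%R, K%:R]) oscillation n N r z th t)%R.
Proof.
have bo := bm_oscillation n N r z th.
elim: K => [|K IH]; first by rewrite big_ord0 set_itv1 Rintegral_set1.
rewrite big_ord_recr/= IH.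
rewrite [RHS](_ : _ = (\int[mu]_(t in `[0%R, K%:R]) oscillation n N r z th t)%R +
    (\int[mu]_(t in `[K%:R, K.+1%:R]) oscillation n N r z th t)%R); last first.
  rewrite -[X in _ = _ + X]Rintegral_itv_obnd_cbnd; last first.
    by apply: integrableS (bm_integrable K%:R K.+1%:R bo) => //; exact: subset_itv_oc_cc.
  rewrite -(@Rintegral_itvB R (oscillation n N r z th) (BLeft 0%R) (BRight K.+1%:R) K%:R).
  - by rewrite addrC subrK.
  - exact: bm_integrable.
  - by rewrite bnd_simp.
  - by rewrite bnd_simp ler_nat.
congr (_ + _).
rewrite /mean_oscillation (@Rintegral_itv_prob 1 ltr01); last 2 first.
- exact: bm_oscillation.
- by move=> t; exact: oscillation_ge0.
rewrite invr1 mul1r /Rintegral; congr fine.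
rewrite -(@ge0_integral_shift R K%:R `[K%:R, K.+1%:R] (fun t => (oscillation n N r z th t)%:E))//.
- rewrite (_ : _ @^-1` _ = `[0%R, 1%R]%classic); last first.
    by apply/seteqP; split => t /=; rewrite !in_itv/= lerDr -natr1 addrC lerD2l.
  apply: eq_integral => t _; congr (_%:E); apply: oscillation_cos => j.
  by congr cos; ring.
- by apply/measurable_EFinP; exact: measurable_oscillation_time.
- by move=> t; rewrite lee_fin oscillation_ge0.
Qed.

End mean_oscillation_time.

Section paths.
Context d (T : measurableType d) (R : realType) (P : probability T R).
Variables (F : set_system T) (Y : nat -> {RV P >-> R}) (r z : nat -> T -> R).
Hypotheses (FI : setI_closed F) (FT : F [set: T]) (Fm : F `<=` measurable).
Hypothesis indepY : independent_RVs P (fun j => Y j : T -> R).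
Hypothesis indepFY : independent2 P F (sigma_gen (fun j => Y j : T -> R)).
Hypothesis unifY : forall k, has_law (Y k) (uniform_prob (twopi_gt0 R)).
Hypothesis rF : forall k (B : set R), measurable B -> F (r k @^-1` B).
Hypothesis zF : forall k (B : set R), measurable B -> F (z k @^-1` B).
Variable X : R -> T -> R.
Hypothesis mX : measurable_fun [set: T * R] (fun p : T * R => X p.2 p.1).

Definition partial_path (n : nat) (x : T * R) : R :=
  phase_sum (r ^~ x.1) (Y ^~ x.1) (z ^~ x.1) n x.2.

Hypothesis SX : forall t, {ae P, forall w,
  (fun n => partial_path n (w, t)) @ \oo --> X t w}.

Let mF (f : T -> R) : (forall B : set R, measurable B -> F (f @^-1` B)) ->
  measurable_fun setT f.
Proof. by move=> fF _ B mB; rewrite setTI; exact/Fm/fF. Qed.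

Let X' (x : T * R) := X x.2 x.1.

Lemma measurable_partial_path n : measurable_fun [set: T * R] (partial_path n).
Proof.
have mfst (f : T -> R) : measurable_fun setT f ->
    measurable_fun [set: T * R] (fun x => f x.1).
  by move=> mf; exact: measurableT_comp mf measurable_fst.
apply: (@measurable_phase_sum_param _ _ (T * R)%type (fun k x => r k x.1)
  (fun k x => z k x.1) (fun k x => Y k x.1) snd) => // k; apply: mfst => //.
- exact: mF (rF k).
- exact: mF (zF k).
Qed.

Lemma oscillation_le_tail n N w t :
  oscillation n N (r ^~ w) (z ^~ w) (Y ^~ w) t <= 2 * tail_dist partial_path X' n (w, t).
Proof.
have tail0 : 0 <= tail_dist partial_path X' n (w, t).
  by have /andP[] := tail_dist01 partial_path X' n (w, t).
rewrite /oscillation big_seq_cond; apply: bigmax_le => [|m].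
  by rewrite mulr_ge0.
rewrite mem_index_iota andbT => /andP[nm _].
have h1 := le_tail_dist partial_path X' (w, t) nm.
have h2 := le_tail_dist partial_path X' (w, t) (leqnn n).
rewrite mulr_natl mulr2n; apply: le_trans (lerD h1 h2).
rewrite /trunc_dist /partial_path/=.
set u := phase_sum _ _ _ m t; set v := phase_sum _ _ _ n t.
have := ler_distD (X' (w, t)) u v; rewrite [`|X' (w, t) - v|]distrC.
have := normr_ge0 (u - X' (w, t)); have := normr_ge0 (v - X' (w, t)).
move: `|u - v| `|u - X' (w, t)| `|v - X' (w, t)| => p1 p2 p3 ? ? ?.
by case: (leP 1 p1) => ?; case: (leP 1 p2) => ?; case: (leP 1 p3) => ?; lra.
Qed.

Let osc (n N i : nat) (w : T) : R :=
  mean_oscillation n N (r ^~ w) (z ^~ w) (fun k => Y k w + i%:R * z k w).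

(** A single index [M] bounds the rank of the partial sums and the number of time
    steps, so that the events increase to the one that bounds neither. *)
Let E (n : nat) (a : R) (M : nat) : set T :=
  [set w | 0 < max_sum a M (fun i => osc n M i w)].

Let mosc n N i : measurable_fun setT (osc n N i).
Proof.
apply: measurable_mean_oscillation => k; [exact: mF (rF k)|exact: mF (zF k)|].
by apply: measurable_funD => //; apply: measurable_funM => //; exact: mF (zF k).
Qed.

Let mE n a M : measurable (E n a M).
Proof.
rewrite (_ : E n a M = [set: T] `&`
    (fun w => max_sum a M (fun i => osc n M i w)) @^-1` `]0, +oo[%classic).
  by apply: measurable_max_sum => // i; exact: mosc.
by rewrite setTI; apply/seteqP; split => w /=; rewrite in_itv/= andbT.
Qed.

Lemma mean_oscillation_le n N N' (r' z' th' : nat -> R) : (N <= N')%N ->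
  mean_oscillation n N r' z' th' <= mean_oscillation n N' r' z' th'.
Proof.
move=> NN'; rewrite -lee_fin !EFin_mean_oscillation; apply: ge0_le_integral => //.
- by move=> t _; rewrite lee_fin oscillation_ge0.
- by apply/measurable_EFinP; exact: measurable_oscillation_time.
- by apply/measurable_EFinP; exact: measurable_oscillation_time.
- by move=> t _; rewrite lee_fin; exact: le_bigmax_nat.
Qed.

Let ndE n a : nondecreasing_seq (E n a).
Proof.
move=> M M' MM'; apply/subsetPset => w /=; rewrite /E/= => h.
apply: lt_le_trans h _; apply: le_max_sum => // i.
exact: mean_oscillation_le.
Qed.

Let le_E n (a : R) M : 0 < a -> (P (E n a M) <=
  (2 / a)%:E * \int[P]_w (mean_tail partial_path X' (unit_prob R) n w)%:E)%E.
Proof.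
move=> a0.
have := maximal_oscillation FI FT Fm indepY indepFY unifY rF zF n M M (ltW a0).
rewrite -/(E n a M) -lee_pdivlMl// => /le_trans; apply.
rewrite mulrC EFinM -muleA; apply: lee_wpmul2l; first by rewrite lee_fin invr_ge0 ltW.
have mtail : measurable_fun setT (mean_tail partial_path X' (unit_prob R) n).
  exact: measurable_mean_tail measurable_partial_path mX _ _.
rewrite -ge0_integralZl//; last 2 first.
- exact/measurable_EFinP.
- by move=> w _; rewrite lee_fin mean_tail_ge0.
apply: ge0_le_integral => //.
- by move=> w _; rewrite lee_fin; have /andP[] := mean_oscillation01 n M (r ^~ w) (z ^~ w) (Y ^~ w).
- apply/measurable_EFinP; apply: measurable_mean_oscillation => k //; [exact: mF (rF k)|exact: mF (zF k)].
- by apply: measurable_funeM; exact/measurable_EFinP.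
move=> w _; rewrite EFin_mean_oscillation EFin_mean_tail; last 2 first.
- exact: measurable_partial_path.
- exact: mX.
have mt : measurable_fun [set: measurableTypeR R]
    (fun t => (tail_dist partial_path X' n (w, t))%:E).
  apply/measurable_EFinP.
  exact: (measurableT_comp (measurable_tail_dist measurable_partial_path mX n) (pair1_measurable w)).
have t0 t : 0 <= tail_dist partial_path X' n (w, t).
  by have /andP[] := tail_dist01 partial_path X' n (w, t).
rewrite -ge0_integralZl//; last by move=> t _; rewrite lee_fin.
apply: ge0_le_integral => //.
- by move=> t _; rewrite lee_fin oscillation_ge0.
- by apply/measurable_EFinP; exact: measurable_oscillation_time.
- exact: measurable_funeM.
- by move=> t _; rewrite -EFinM lee_fin oscillation_le_tail.
Qed.

(** The maximal inequality bounds the probability of the complementary event at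
    rank [n] by a multiple of the mean of [mean_tail], which tends to 0. *)
Lemma ae_oscillation_small (a : R) : 0 < a ->
  {ae P, forall w, exists n, forall N (K : nat),
    (\int[lebesgue_measure]_(t in `[0%R, K%:R])
       oscillation n N (r ^~ w) (z ^~ w) (Y ^~ w) t)%R <= a * K%:R}.
Proof.
move=> a0.
have h : {ae P, forall w, exists n, ~ (\bigcup_M E n a M) w}.
  apply: (@ae_exists_notin _ _ _ P (fun n => \bigcup_M E n a M)
    (fun n => (2 / a)%:E * \int[P]_w (mean_tail partial_path X' (unit_prob R) n w)%:E)%E).
  - by move=> n; exact: bigcupT_measurable.
  - move=> n; have mU : measurable (\bigcup_M E n a M) by exact: bigcupT_measurable.
    have cE := nondecreasing_cvg_mu (mu := P) (mE n a) mU (@ndE n a).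
    by apply: (cvge_to_le cE); apply: nearW => M; exact: le_E.
  - rewrite -[0%E](mule0 (2 / a)%:E); apply: cvgeM; [|exact: cvg_cst|] => //.
    exact: mean_tail_cvg0 measurable_partial_path mX SX _.
apply: filterS h => w [n nE]; exists n => N K.
rewrite -sum_mean_oscillation.
pose M := maxn N K.
have KM : (K < M.+1)%N by rewrite ltnS leq_maxr.
have ME : max_sum a M (fun i => osc n M i w) <= 0.
  by rewrite leNgt; apply/negP => Ew; apply: nE; exists M.
have := le_trans (le_bigmax _ (fun K : 'I_M.+1 => \sum_(i < K) (osc n M i w - a))
  (Ordinal KM)) ME.
rewrite /= sumrB sumr_const card_ord subr_le0 mulr_natr => h1.
apply: le_trans h1.
by apply: ler_sum => i _; apply: mean_oscillation_le; exact: leq_maxl.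
Qed.

(** On a fixed interval of time, unlike on all of them at once, dominated
    convergence is enough. *)
Lemma ae_partial_path_close :
  {ae P, forall w, forall (K : nat) (e : R), 0 < e -> exists n, forall m, (n <= m)%N ->
    (\int[lebesgue_measure]_(t in `[0%R, K%:R])
       Num.min 1 `|partial_path m (w, t) - X t w|)%R <= e}.
Proof.
have h (i : nat) : {ae P, forall w, forall p : nat * nat, unpickle i = Some p ->
    exists n, mean_tail partial_path X' (uniform_prob (ltr0Sn R p.1)) n w < p.2.+1%:R^-1}.
  (* The horizon is [K.+1], as an interval of length 0 carries no uniform law. *)
  case: (unpickle i) => [[K j]|]; last by apply: aeW.
  have j0 : 0 < j.+1%:R^-1 :> R by rewrite invr_gt0.
  have := ae_mean_tail_small measurable_partial_path mX SX (uniform_prob (ltr0Sn R K)) j0.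
  by apply: filterS => w hw _ [<-].
apply: filterS (ae_foralln h) => w hw K e e0.
pose j := Num.truncn (K.+1%:R / e).
have [n nj] := hw (pickle (K, j)) (K, j) (pickleK _).
exists n => m nm.
have bT : bounded_measurable (fun t => tail_dist partial_path X' n (w, t)).
  split.
    exact: (measurableT_comp (measurable_tail_dist measurable_partial_path mX n) (pair1_measurable w)).
  exists 1 => t; rewrite ger0_norm; have /andP[] := tail_dist01 partial_path X' n (w, t) => //.
have T0 t : 0 <= tail_dist partial_path X' n (w, t).
  by have /andP[] := tail_dist01 partial_path X' n (w, t).
move: nj; rewrite /mean_tail Rintegral_itv_prob// mulrC ltr_pdivrMr//= => nj.
have bD : bounded_measurable (fun t => trunc_dist partial_path X' m (w, t)).
  split.
    exact: (measurableT_comp (measurable_trunc_dist measurable_partial_path mX m) (pair1_measurable w)).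
  exists 1 => t; rewrite ger0_norm; have /andP[] := trunc_dist01 partial_path X' m (w, t) => //.
apply: le_trans (_ : (\int[lebesgue_measure]_(t in `[0%R, K.+1%:R])
    tail_dist partial_path X' n (w, t))%R <= _).
  apply: le_trans (_ : (\int[lebesgue_measure]_(t in `[0%R, K.+1%:R])
    trunc_dist partial_path X' m (w, t))%R <= _).
    apply: (Rintegral_itv_widen (A := K%:R) (B := K.+1%:R) bD) => [t|];
      last by rewrite ler_nat.
    by have /andP[] := trunc_dist01 partial_path X' m (w, t).
  apply: le_Rintegral => //; [exact: bm_integrable bD|exact: bm_integrable bT|].
  by move=> t _; exact: le_tail_dist.
apply: (le_trans (ltW nj)).
rewrite ler_pdivrMl// -ler_pdivrMr//.
by apply: ltW; exact: truncnS_gt.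
Qed.

Lemma phase_sum_scale (l : R) (a th z' : nat -> R) n t :
  phase_sum (fun k => l * a k) th z' n t = l * phase_sum a th z' n t.
Proof. by rewrite /phase_sum mulr_sumr; apply: eq_bigr => k _; rewrite mulrA. Qed.

(** Pathwise, [equidistribution] gives the mean values of the partial sums, and the
    oscillation bounds allow the passage to the limit. *)
Lemma ae_time_average (l : R) :
  {ae P, forall w, rationally_independent (z ^~ w)} ->
  {ae P, forall w,
    (cvgn (fun n => complex.Re (\prod_(k < n) besselJ0 (l * r k w))) /\
     mean_value (fun t => cos (l * X t w))
       (limn (fun n => complex.Re (\prod_(k < n) besselJ0 (l * r k w))))) /\
    (cvgn (fun n => complex.Im (\prod_(k < n) besselJ0 (l * r k w))) /\
     mean_value (fun t => sin (l * X t w))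
       (limn (fun n => complex.Im (\prod_(k < n) besselJ0 (l * r k w)))))}.
Proof.
move=> zfree.
have small : {ae P, forall w, forall j : nat, exists n, forall N (K : nat),
    (\int[lebesgue_measure]_(t in `[0%R, K%:R])
       oscillation n N (r ^~ w) (z ^~ w) (Y ^~ w) t)%R <= j.+1%:R^-1 * K%:R}.
  by apply: ae_foralln => j; apply: ae_oscillation_small; rewrite invr_gt0.
apply: filterS3 zfree small ae_partial_path_close => w zw osmall close_x.
pose p n := \prod_(k < n) besselJ0 (l * r k w).
have mXw : measurable_fun [set: R] (fun t => X t w).
  exact: (measurableT_comp mX (pair1_measurable w)).
have mSw n : measurable_fun [set: R] (fun t => partial_path n (w, t)).
  exact: (measurableT_comp (measurable_partial_path n) (pair1_measurable w)).
have C0 : 0 < 2 + `|l| by rewrite ltr_wpDr.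
have close_s a : 0 < a -> exists n, forall m (K : nat), (n <= m)%N ->
    (\int[lebesgue_measure]_(t in `[0%R, K%:R])
      Num.min 1 `|partial_path m (w, t) - partial_path n (w, t)|)%R <= a * K%:R.
  move=> a0; have [n on] := osmall (Num.truncn a^-1); exists n => m K nm.
  apply: le_trans (_ : (\int[lebesgue_measure]_(t in `[0%R, K%:R])
    oscillation n m.+1 (r ^~ w) (z ^~ w) (Y ^~ w) t)%R <= _).
    apply: le_Rintegral => //.
    - exact: bm_integrable (bm_min_dist (mSw m) (mSw n)).
    - exact: bm_integrable (bm_oscillation _ _ _ _ _).
    - by move=> t _; apply: le_oscillation; rewrite nm ltnSn.
  apply: le_trans (on m.+1 K) _; rewrite ler_wpM2r//.
  by rewrite invf_ple ?posrE//; exact/ltW/truncnS_gt.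
have bm_comp (c : R -> R) : continuous c -> (forall u, `|c u| <= 1) ->
    forall f, measurable_fun [set: R] f -> bounded_measurable (fun t => c (l * f t)).
  move=> cc c1 f mf; split; last by exists 1.
  by apply: (measurableT_comp (continuous_measurable_fun cc)); exact: measurable_funM.
have cos1 (u : R) : `|cos u| <= 1 by rewrite ler_norml cos_geN1 cos_le1.
have sin1 (u : R) : `|sin u| <= 1 by rewrite ler_norml sin_geN1 sin_le1.
have equi n := equidistribution (fun k => l * r k w) (Y ^~ w) n zw.
have path n t : phase_sum (fun k => l * r k w) (Y ^~ w) (z ^~ w) n t =
    l * partial_path n (w, t) by exact: phase_sum_scale.
split.
- apply: (@mean_value_limit R (fun n t => cos (l * partial_path n (w, t)))
    (fun t => cos (l * X t w)) (fun n => complex.Re (p n)) (2 + `|l|)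
    (fun n t => partial_path n (w, t)) (fun t => X t w)) => //.
  + by move=> n; exact: (bm_comp _ (@continuous_cos R) cos1).
  + exact: (bm_comp _ (@continuous_cos R) cos1).
  + move=> n; have [h _] := equi n; move: h; congr mean_value.
    by apply/funext => t; rewrite path.
  + by move=> m n t; exact: (trunc_lipschitz l _ _ cos1 (@dist_cos R)).
  + move=> m t; rewrite distrC [`|_ - X t w|]distrC.
    rewrite [leLHS]distrC; exact: (trunc_lipschitz l _ _ cos1 (@dist_cos R)).
- apply: (@mean_value_limit R (fun n t => sin (l * partial_path n (w, t)))
    (fun t => sin (l * X t w)) (fun n => complex.Im (p n)) (2 + `|l|)
    (fun n t => partial_path n (w, t)) (fun t => X t w)) => //.
  + by move=> n; exact: (bm_comp _ (@continuous_sin R) sin1).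
  + exact: (bm_comp _ (@continuous_sin R) sin1).
  + move=> n; have [_ h] := equi n; move: h; congr mean_value.
    by apply/funext => t; rewrite path.
  + by move=> m n t; exact: (trunc_lipschitz l _ _ sin1 (@dist_sin R)).
  + move=> m t; rewrite distrC [`|_ - X t w|]distrC.
    rewrite [leLHS]distrC; exact: (trunc_lipschitz l _ _ sin1 (@dist_sin R)).
Qed.

End paths.

Section complex_limits.
Context (R : realType).

Lemma cvg_complex (I : Type) (F : set_system I) {FF : Filter F} (u : I -> R[i]) (c : R[i]) :
  complex.Re (u i) @[i --> F] --> complex.Re c ->
  complex.Im (u i) @[i --> F] --> complex.Im c ->
  (u i : R[i]^o) @[i --> F] --> (c : R[i]^o).
Proof.
move=> uRe uIm; apply/cvgrPdist_lt => -[e e'].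
rewrite ltcE/= => /andP[/eqP -> e0].
have e2 : 0 < e / 2 by rewrite divr_gt0.
move/cvgrPdist_lt : uRe => /(_ _ e2); move/cvgrPdist_lt : uIm => /(_ _ e2).
apply: filterS2 => i hIm hRe.
rewrite normc_def (_ : e +i* 0 = e%:C)// ltcR !raddfB/=.
set x := complex.Re c - _ in hRe *; set y := complex.Im c - _ in hIm *.
have xy : x ^+ 2 + y ^+ 2 <= (`|x| + `|y|) ^+ 2.
  rewrite -(real_normK (num_real x)) -(real_normK (num_real y)) sqrrD lerD2r lerDl.
  by rewrite mulrn_wge0// mulr_ge0.
apply: le_lt_trans (ler_wsqrtr xy) _.
rewrite sqrtr_sqr ger0_norm ?addr_ge0//.
by rewrite [ltRHS](splitr e); exact: ltrD.
Qed.

Lemma cvg_Re (I : Type) (F : set_system I) {FF : Filter F} (u : I -> R[i]) (c : R[i]) :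
  (u i : R[i]^o) @[i --> F] --> (c : R[i]^o) ->
  complex.Re (u i) @[i --> F] --> complex.Re c.
Proof.
move=> uc; apply/cvgrPdist_lt => e e0.
have e0' : 0 < e%:C by rewrite ltcR.
move/cvgrPdist_lt : uc => /(_ _ e0'); apply: filterS => i.
rewrite normc_def ltcR !raddfB/=; apply: le_lt_trans.
by rewrite -sqrtr_sqr ler_wsqrtr// lerDl sqr_ge0.
Qed.

End complex_limits.

(** * Integrating out the phases *)

Section uniform_average.
Context (R : realType).
Notation mu := (@lebesgue_measure R).

(** A translation by half a turn exchanges the two intervals of length [2 * pi] on
    which uniform laws and Bessel functions are defined. *)
Lemma uniform_average (p : R -> R) : bounded_measurable p -> (forall u, 0 <= p u) ->
  (forall u, p (u + 2 * pi) = p u) ->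
  (\int[uniform_prob (twopi_gt0 R)]_u (p u)%:E)%E = (period_average p)%:E.
Proof.
move=> bp p0 per; have mp : measurable_fun [set: R] (fun u => (p u)%:E).
  by case: bp => mp _; exact/measurable_EFinP.
rewrite -(uniform_prob_shift (- pi) mp); last 2 first.
- by move=> u; rewrite lee_fin.
- by move=> u; rewrite per.
have mps : measurable_fun [set: R] (fun u => (p (u - pi))%:E).
  by apply: (measurableT_comp mp); exact: measurable_funD.
rewrite integral_uniform//; last by move=> u; rewrite lee_fin.
have fin : (\int[mu]_(u in `[(- pi)%R, pi%R]) (p u)%:E)%E \is a fin_num.
  exact: integrable_fin_num (bm_integrable (- pi) pi bp).
rewrite /period_average /Rintegral EFinM fineK// subr0; congr (_ * _)%E.
rewrite -(@ge0_integral_shift R (- pi) `[- pi, pi] (fun u => (p u)%:E))//.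
congr (integral _ _ _); apply/seteqP; split => u /=; rewrite !in_itv/= => /andP[? ?];
  apply/andP; split; lra.
Qed.

(** [besselJ0] is complex-valued, but its imaginary part vanishes by symmetry. *)
Definition realJ0 (s : R) : R := period_average (fun u => cos (s * cos u)).

(** Half a turn changes the sign of the cosine. *)
Lemma period_average_sin_cos (s : R) : period_average (fun u => sin (s * cos u)) = 0.
Proof.
have per u : cos (u + 2 * pi) = cos u :> R.
  by rewrite mulr_natl cosD2pi.
have bs := bm_sin_scaled_cos s.
(* The constant 1 keeps the integrands nonnegative. *)
have bound a u : a = 1 \/ a = -1 -> 0 <= 1 * 1 + a * sin (s * cos u).
  by have := sin_geN1 (s * cos u); have := sin_le1 (s * cos u) => ? ? [->|->]; lra.
have bm1 a : bounded_measurable (fun u => 1 * 1 + a * sin (s * cos u)).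
  exact: bmD (bm_cst _) (bmM (bm_cst a) bs).
have avg a : period_average (fun u => 1 * 1 + a * sin (s * cos u)) =
    1 * 1 + a * period_average (fun u => sin (s * cos u)).
  by rewrite (period_average_lin 1 a (bm_cst 1) bs) period_average_cst.
have e1 : (\int[uniform_prob (twopi_gt0 R)]_u (1 * 1 + 1 * sin (s * cos u))%:E)%E =
  (\int[uniform_prob (twopi_gt0 R)]_u (1 * 1 + (-1) * sin (s * cos u))%:E)%E.
  rewrite -(@uniform_prob_shift R pi (fun u => (1 * 1 + 1 * sin (s * cos u))%:E)).
  - by apply: eq_integral => u _; rewrite cosDpi mulrN sinN mulN1r !mul1r.
  - by apply/measurable_EFinP; case: (bm1 1).
  - by move=> u; rewrite lee_fin; apply: bound; left.
  - by move=> u; rewrite per.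
move: e1; rewrite !uniform_average//.
- by rewrite !avg => -[]; lra.
- by move=> u; rewrite per.
- by move=> u; rewrite per.
Qed.

Lemma besselJ0_real (s : R) : besselJ0 s = (realJ0 s)%:C.
Proof. by rewrite besselJ0E period_average_sin_cos. Qed.

Lemma realJ0_le1 (s : R) : `|realJ0 s| <= 1.
Proof.
rewrite -[realJ0 s]subr0 -[X in _ - X](period_average_cst 0).
apply: period_average_near; [exact: bm_cos_scaled_cos|exact: bm_cst|].
by move=> u; rewrite subr0 ler_norml cos_geN1 cos_le1.
Qed.

Lemma measurable_realJ0 : measurable_fun [set: R] realJ0.
Proof.
apply: continuous_measurable_fun => s; apply/cvgrPdist_le => e e0.
near=> s'.
apply: le_trans (_ : `|s - s'| <= e); last first.
  by near: s'; have /cvgrPdist_le := @cvg_id _ (nbhs s); apply.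
apply: period_average_near; [exact: bm_cos_scaled_cos..|] => u.
apply: le_trans (dist_cos _ _) _; rewrite -mulrBl.
by rewrite normrM ler_piMr// ler_norml cos_geN1 cos_le1.
Unshelve. all: by end_near. Qed.

(** The constant 1 and the sign of [a] keep the integrand nonnegative, as Tonelli's
    theorem requires. *)
Lemma uniform_phase (a c phi s b : R) : 0 <= a -> `|c| <= 1 ->
  (\int[uniform_prob (twopi_gt0 R)]_y
     (a * (1 + c * cos (phi + s * cos (y + b))))%:E)%E =
  (a * (1 + c * realJ0 s * cos phi))%:E.
Proof.
move=> a0 c1.
pose H y : R := a * 1 + a * c * (cos phi * cos (s * cos y) + (- sin phi) * sin (s * cos y)).
have HE y : a * (1 + c * cos (phi + s * cos y)) = H y.
  by rewrite cosD /H; move: (cos _) (sin _) (cos _) (sin _) => *; ring.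
have bH : bounded_measurable H.
  apply: bmD (bm_cst _) (bmM (bm_cst _) _).
  exact: bmD (bmM (bm_cst _) (bm_cos_scaled_cos s)) (bmM (bm_cst _) (bm_sin_scaled_cos s)).
have H0 y : 0 <= H y.
  rewrite -HE mulr_ge0// -lerBlDl sub0r.
  have : `|c * cos (phi + s * cos y)| <= 1.
    by rewrite normrM mulr_ile1// ler_norml cos_geN1 cos_le1.
  by rewrite ler_norml => /andP[].
have Hper y : H (y + 2 * pi) = H y by rewrite /H mulr_natl cosD2pi.
under eq_integral do rewrite HE.
rewrite (@uniform_prob_shift R b (fun y => (H y)%:E)).
- rewrite uniform_average// /H; congr EFin.
  rewrite period_average_lin ?period_average_cst//; [|exact: bm_cst|]; last first.
    exact: bmD (bmM (bm_cst _) (bm_cos_scaled_cos s)) (bmM (bm_cst _) (bm_sin_scaled_cos s)).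
  rewrite period_average_lin; [|exact: bm_cos_scaled_cos|exact: bm_sin_scaled_cos].
  by rewrite period_average_sin_cos -/(realJ0 s); ring.
- by case: bH => mH _; exact/measurable_EFinP.
- by move=> y; rewrite lee_fin.
- by move=> y; rewrite Hper.
Qed.

End uniform_average.

Section integrate_phases.
Context d (T : measurableType d) (R : realType) (P : probability T R).
Variables (F : set_system T) (Y : nat -> {RV P >-> R}) (s b : nat -> T -> R).
Hypotheses (FI : setI_closed F) (FT : F [set: T]) (Fm : F `<=` measurable).
Hypothesis indepY : independent_RVs P (fun j => Y j : T -> R).
Hypothesis indepFY : independent2 P F (sigma_gen (fun j => Y j : T -> R)).
Hypothesis unifY : forall k, has_law (Y k) (uniform_prob (twopi_gt0 R)).
Hypothesis sF : forall k (B : set R), measurable B -> F (s k @^-1` B).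
Hypothesis bF : forall k (B : set R), measurable B -> F (b k @^-1` B).

Lemma prod_realJ0_le1 n w : `|\prod_(i < n) realJ0 (s i w)| <= 1.
Proof.
elim/big_ind: _ => [|x y x1 y1|i _]; [by rewrite normr1| |exact: realJ0_le1].
by rewrite normrM mulr_ile1.
Qed.

(** One phase is integrated out at a time, which replaces the corresponding
    exponential factor by a Bessel function. *)
Lemma integrate_phases (A : set T) n om : F A ->
  (\int[P]_w (\1_A w * (1 + cos (\sum_(0 <= i < n) s i w * cos (Y i w + b i w) + om)))%:E =
   \int[P]_w (\1_A w * (1 + \prod_(i < n) realJ0 (s i w) * cos om))%:E)%E.
Proof.
move=> FA.
pose I k w : R := \1_A w * (1 + \prod_(i < k) realJ0 (s i w) *
  cos (\sum_(k <= i < n) s i w * cos (Y i w + b i w) + om)).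
have step k : (k < n)%N -> (\int[P]_w (I k.+1 w)%:E = \int[P]_w (I k w)%:E)%E.
  move=> kn; pose O := others F Y n k.
  have mO (f : T -> R) : measurable_fun setT (f : O -> R) ->
      measurable_fun [set: O * R] (fun x => f x.1).
    by move=> mf; exact: measurableT_comp mf measurable_fst.
  have mF (f : T -> R) : (forall B : set R, measurable B -> F (f @^-1` B)) ->
      measurable_fun setT (f : O -> R).
    by move=> mf; exact: others_sys_measurable.
  pose phi w : R := \sum_(k.+1 <= i < n) s i w * cos (Y i w + b i w) + om.
  pose c w : R := \prod_(i < k) realJ0 (s i w).
  pose hr (x : O * R) : R :=
    \1_A (x.1 : T) * (1 + c x.1 * cos (phi x.1 + s k x.1 * cos (x.2 + b k x.1))).
  have mA : measurable (A : set O).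
    apply: sub_sigma_algebra; exists A, (fun=> setT); split => //.
    by rewrite bigcapT ?setIT//; apply/seteqP; split.
  have mcos dE (E : measurableType dE) (f : E -> R) : measurable_fun setT f ->
      measurable_fun setT (fun e => cos (f e)).
    move=> mf; apply: (measurableT_comp _ mf).
    by apply: continuous_measurable_fun; exact: continuous_cos.
  have mc : measurable_fun setT (c : O -> R).
    apply: measurable_prod => i _; apply: (measurableT_comp (@measurable_realJ0 R)).
    exact: mF (sF i).
  have mphi : measurable_fun setT (phi : O -> R).
    apply: measurable_funD; last exact: measurable_cst.
    pose g i (w : O) := if i \in index_iota k.+1 n
      then s i w * cos (Y i w + b i w) else 0.
    rewrite (_ : (fun w => _) = fun w => \sum_(i <- index_iota k.+1 n) g i w); last first.
      by apply/funext => w; apply: eq_big_seq => i; rewrite /g => ->.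
    apply: measurable_sum => i; rewrite /g.
    case: (boolP (i \in index_iota k.+1 n)) => [|_]; last exact: measurable_cst.
    rewrite mem_index_iota => /andP[ki jn].
    apply: measurable_funM; first exact: mF (sF i).
    apply: (mcos _ _ _); apply: measurable_funD; last exact: mF (bF i).
    by apply: others_rv_measurable; rewrite ?gtn_eqF.
  have mhr : measurable_fun [set: O * R] hr.
    apply: measurable_funM; first by apply: (mO (\1_A)); exact: measurable_indic.
    apply: measurable_funD; first exact: measurable_cst.
    apply: measurable_funM; first exact: (mO c).
    apply: (mcos _ _ _); apply: measurable_funD; first exact: (mO phi).
    apply: measurable_funM; first exact: (mO (s k) (mF _ (sF k))).
    apply: (mcos _ _ _); apply: measurable_funD; first exact: measurable_snd.
    exact: (mO (b k) (mF _ (bF k))).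
  have hr0 x : 0 <= hr x.
    rewrite mulr_ge0// -lerBlDl sub0r.
    have : `|c x.1 * cos (phi x.1 + s k x.1 * cos (x.2 + b k x.1))| <= 1.
      by rewrite normrM mulr_ile1 ?prod_realJ0_le1// ler_norml cos_geN1 cos_le1.
    by rewrite ler_norml => /andP[].
  have mh : measurable_fun [set: O * R] (fun x => (hr x)%:E) by exact/measurable_EFinP.
  have h0 (x : O * R) : (0 <= (hr x)%:E)%E by rewrite lee_fin.
  have Ik w : I k w = hr ((w : O), Y k w).
    rewrite /I /hr/= /phi big_ltn//; congr (_ * (1 + _ * cos _)).
    by rewrite [RHS]addrC addrA.
  under [RHS]eq_integral do rewrite Ik.
  rewrite (others_integral FI FT Fm indepY indepFY mh h0).
  apply: eq_integral => w _.
  have mhw : measurable_fun [set: R] (fun y => (hr ((w : O), y))%:E).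
    exact: (measurableT_comp mh (pair1_measurable (w : O))).
  rewrite (integral_law (unifY k) mhw)//.
  rewrite /hr/= uniform_phase ?prod_realJ0_le1//.
  by rewrite /I big_ord_recr.
have I0 w : \1_A w * (1 + cos (\sum_(0 <= i < n) s i w * cos (Y i w + b i w) + om)) = I 0%N w.
  by rewrite /I big_ord0 mul1r.
have In w : \1_A w * (1 + \prod_(i < n) realJ0 (s i w) * cos om) = I n w.
  by rewrite /I big_geq// add0r.
under eq_integral do rewrite I0; under [RHS]eq_integral do rewrite In.
have I0k k : (k <= n)%N -> (\int[P]_w (I 0%N w)%:E = \int[P]_w (I k w)%:E)%E.
  by elim: k => [//|k IH] kn; rewrite step// IH// ltnW.
exact: I0k.
Qed.

Lemma Rintegral_indic_1D (A : set T) (f : T -> R) : measurable A ->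
  measurable_fun setT f -> (forall w, `|f w| <= 1) ->
  (\int[P]_w (\1_A w * (1 + f w))%:E)%E = (Rintegral P A (fun w => 1 + f w))%:E.
Proof.
move=> mA mf f1.
have i1f : P.-integrable A (EFin \o (fun w => 1 + f w)).
  apply: (@bounded_measurable_integrable _ _ _ _ _ _ 2) => //.
  - by rewrite ltey_eq fin_num_measure.
  - by apply: measurable_funD.
  - move=> w; apply: le_trans (ler_normD _ _) _; rewrite normr1.
    by have := f1 w => ?; lra.
rewrite /Rintegral fineK; last exact: integrable_fin_num i1f.
rewrite [RHS]integral_mkcond.
apply: eq_integral => w _; rewrite patchE indicE.
by case: (w \in A); rewrite ?mul1r ?mul0r.
Qed.

Lemma Rintegral_phases (A : set T) n om : F A ->
  Rintegral P A (fun w => cos (\sum_(i < n) s i w * cos (Y i w + b i w) + om)) =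
  cos om * Rintegral P A (fun w => \prod_(i < n) realJ0 (s i w)).
Proof.
move=> FA; have mA := Fm FA.
have mF (f : T -> R) : (forall B : set R, measurable B -> F (f @^-1` B)) ->
    measurable_fun setT f.
  by move=> fF _ B mB; rewrite setTI; exact/Fm/fF.
have mcos (f : T -> R) : measurable_fun setT f ->
    measurable_fun setT (fun e => cos (f e)).
  move=> mf; apply: (measurableT_comp _ mf).
  by apply: continuous_measurable_fun; exact: continuous_cos.
have mS : measurable_fun setT (fun w => cos (\sum_(i < n) s i w * cos (Y i w + b i w) + om)).
  apply: (mcos _ _); apply: measurable_funD; last exact: measurable_cst.
  apply: measurable_sum => i; apply: measurable_funM; first exact: mF (sF i).
  by apply: (mcos _ _); apply: measurable_funD => //; exact: mF (bF i).
have mP : measurable_fun setT (fun w => \prod_(i < n) realJ0 (s i w)).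
  apply: measurable_prod => i _; apply: (measurableT_comp (@measurable_realJ0 R)).
  exact: mF (sF i).
have cos1 (u : R) : `|cos u| <= 1 by rewrite ler_norml cos_geN1 cos_le1.
have intA (f : T -> R) : measurable_fun setT f -> (forall w, `|f w| <= 1) ->
    P.-integrable A (EFin \o f).
  move=> mf f1; apply: (@bounded_measurable_integrable _ _ _ _ _ _ 1) => //.
  by rewrite ltey_eq fin_num_measure.
have P1 w : `|\prod_(i < n) realJ0 (s i w) * cos om| <= 1.
  by rewrite normrM mulr_ile1// prod_realJ0_le1.
have mPc : measurable_fun setT (fun w => \prod_(i < n) realJ0 (s i w) * cos om).
  exact: measurable_funM.
have := integrate_phases n om FA.
under eq_integral do rewrite big_mkord.
rewrite !Rintegral_indic_1D// => -[].
rewrite !RintegralD//; try exact: intA; last 2 first.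
- by apply: intA => // w; rewrite normr1.
- by apply: intA => // w; rewrite normr1.
move/addrI => ->; rewrite RintegralZr//; first by rewrite mulrC.
by apply: intA => // w; exact: prod_realJ0_le1.
Qed.

Lemma Rintegral_dominated_cvg (A : set T) (f_ : nat -> T -> R) (f : T -> R) :
  measurable A -> (forall n, measurable_fun setT (f_ n)) -> measurable_fun setT f ->
  (forall n w, `|f_ n w| <= 1) ->
  {ae P, forall w, f_ ^~ w @ \oo --> f w} ->
  Rintegral P A (f_ n) @[n --> \oo] --> Rintegral P A f.
Proof.
move=> mA mf_ mf f1 ff.
have [|||||fi _ fcvg] := @dominated_convergence _ _ _ P A mA
  (fun n w => (f_ n w)%:E) (fun w => (f w)%:E) (cst 1%E).
- by move=> n; apply: measurable_funTS; exact/measurable_EFinP.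
- by apply: measurable_funTS; exact/measurable_EFinP.
- by apply: filterS ff => w fw _; apply: cvg_EFin => //; exact: nearW.
- apply: (@bounded_measurable_integrable _ _ _ P A (cst 1) 1) => //.
    by rewrite ltey_eq fin_num_measure.
  by move=> w; rewrite normr1.
- by apply: aeW => w n _; rewrite /= lee_fin.
apply: fine_cvg; rewrite /= fineK; first exact: fcvg.
exact: integrable_fin_num fi.
Qed.

(** The finite sums carry an additive constant [om], so that they cover the sine,
    with [om = - (pi / 2)], as well as the cosine. *)
Lemma Rintegral_limit (A : set T) (x p : T -> R) : F A ->
  measurable_fun setT x -> measurable_fun setT p ->
  {ae P, forall w, (fun n => \sum_(i < n) s i w * cos (Y i w + b i w)) @ \oo --> x w} ->
  {ae P, forall w, (fun n => \prod_(i < n) realJ0 (s i w)) @ \oo --> p w} ->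
  Rintegral P A (fun w => cos (x w)) = Rintegral P A p /\
  Rintegral P A (fun w => sin (x w)) = 0.
Proof.
move=> FA mx mp sx pp; have mA := Fm FA.
have mF (f : T -> R) : (forall B : set R, measurable B -> F (f @^-1` B)) ->
    measurable_fun setT f.
  by move=> fF _ B mB; rewrite setTI; exact/Fm/fF.
have mcos (f : T -> R) : measurable_fun setT f ->
    measurable_fun setT (fun e => cos (f e)).
  move=> mf; apply: (measurableT_comp _ mf).
  by apply: continuous_measurable_fun; exact: continuous_cos.
have mS n : measurable_fun setT (fun w => \sum_(i < n) s i w * cos (Y i w + b i w)).
  apply: measurable_sum => i; apply: measurable_funM; first exact: mF (sF i).
  by apply: (mcos _ _); apply: measurable_funD => //; exact: mF (bF i).
have mP n : measurable_fun setT (fun w => \prod_(i < n) realJ0 (s i w)).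
  apply: measurable_prod => i _; apply: (measurableT_comp (@measurable_realJ0 R)).
  exact: mF (sF i).
have lhs om : Rintegral P A (fun w => cos (\sum_(i < n) s i w * cos (Y i w + b i w) + om))
    @[n --> \oo] --> Rintegral P A (fun w => cos (x w + om)).
  apply: Rintegral_dominated_cvg => //.
  - by move=> n; apply: (mcos _ _); apply: measurable_funD.
  - by apply: (mcos _ _); apply: measurable_funD.
  - by move=> n w; rewrite ler_norml cos_geN1 cos_le1.
  apply: filterS sx => w sw; apply: (continuous_cvg _ (@continuous_cos R _)).
  by apply: cvgD => //; exact: cvg_cst.
have rhs om : Rintegral P A (fun w => cos (\sum_(i < n) s i w * cos (Y i w + b i w) + om))
    @[n --> \oo] --> cos om * Rintegral P A p.
  under eq_fun do rewrite Rintegral_phases//.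
  apply: cvgM; first exact: cvg_cst.
  apply: Rintegral_dominated_cvg => //.
  by move=> n w; exact: prod_realJ0_le1.
have E om : Rintegral P A (fun w => cos (x w + om)) = cos om * Rintegral P A p.
  by have /cvg_lim <- // := lhs om; exact: cvg_lim (rhs om).
split.
  by have := E 0; rewrite cos0 mul1r => <-; under [RHS]eq_Rintegral do rewrite addr0.
have := E (- (pi / 2)); rewrite cosN cos_pihalf mul0r => <-.
by apply: eq_Rintegral => w _; rewrite cosB cos_pihalf sin_pihalf mulr0 mulr1 add0r.
Qed.

End integrate_phases.

(** * Measurability of limits *)

Section measurable_limit.
Context d (T : measurableType d) (R : realType).

(** Cauchy's criterion in terms of countably many conditions, which makes the set
    of convergence measurable. *)
Lemma cvgn_cauchy_nat (u : nat -> R) : cvgn u <->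
  forall j : nat, exists N, forall m, (N <= m)%N -> `|u m - u N| <= j.+1%:R^-1.
Proof.
split=> [cu j|h].
  have j0 : 0 < j.+1%:R^-1 / 2 :> R by rewrite divr_gt0.
  have [N _ uN] : \forall n \near \oo, `|limn u - u n| <= j.+1%:R^-1 / 2.
    by move/cvgrPdist_le : cu; exact.
  exists N => m Nm; have := uN m Nm; have := uN N (leqnn N).
  move: (j.+1%:R^-1) => e /=; rewrite !ler_norml => /andP[? ?] /andP[? ?].
  by apply/andP; split; lra.
apply: cauchy_cvg; apply: cauchy_exP => e e0.
have [N uN] := h (Num.truncn e^-1); exists (u N); exists N => // m /= Nm.
rewrite -ball_normE/= distrC; apply: le_lt_trans (uN m Nm) _.
by rewrite invf_plt ?posrE//; exact: truncnS_gt.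
Qed.

Lemma measurable_cvgn (u : nat -> T -> R) : (forall n, measurable_fun setT (u n)) ->
  measurable [set w | cvgn (u ^~ w)].
Proof.
move=> mu.
rewrite (_ : [set w | _] = \bigcap_j \bigcup_N \bigcap_m
    [set w | (N <= m)%N -> `|u m w - u N w| <= j.+1%:R^-1]); last first.
  apply/seteqP; split => w /=.
    by move/cvgn_cauchy_nat => h j _; have [N hN] := h j; exists N => // m _; exact: hN.
  move=> h; apply/cvgn_cauchy_nat => j; have [N _ hN] := h j I.
  by exists N => m; exact: hN.
apply: bigcapT_measurable => j; apply: bigcupT_measurable => N.
apply: bigcapT_measurable => m; case: (leqP N m) => Nm; last first.
  by rewrite (_ : [set w | _] = setT)//; apply/seteqP; split.
rewrite (_ : [set w | _] = [set: T] `&`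
    (fun w => `|u m w - u N w|) @^-1` `]-oo, j.+1%:R^-1]%classic).
  have mn : measurable_fun setT (fun w => `|u m w - u N w|).
    by apply: (measurableT_comp (@normr_measurable R setT)); exact: measurable_funB.
  by apply: mn => //; exact: measurable_itv.
by rewrite setTI; apply/seteqP; split => w /=; rewrite in_itv/= => h; [exact: h|move=> _].
Qed.

(** [limn] sends divergent sequences to a default value, so that pointwise limits
    stay measurable where convergence fails. *)
Lemma measurable_lim_or_cst (u : nat -> T -> R) (f : T -> R) (c : R) :
  (forall n, measurable_fun setT (u n)) ->
  (forall w, cvgn (u ^~ w) -> f w = limn (u ^~ w)) ->
  (forall w, ~ cvgn (u ^~ w) -> f w = c) ->
  measurable_fun setT f.
Proof.
move=> mu fcvg fncvg; have mC := measurable_cvgn mu.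
set C := [set w | cvgn (u ^~ w)] in mC.
pose v n w := \1_C w * u n w + (1 - \1_C w) * c.
have mI : measurable_fun setT (\1_C : T -> R) by exact: measurable_indic.
apply: (@measurable_fun_cvg _ _ _ setT v f) => [n|w _].
  apply: measurable_funD; first exact: measurable_funM.
  by apply: measurable_funM => //; exact: measurable_funB.
rewrite /v indicE; case: (boolP (w \in C)); rewrite ?inE ?notin_setE => Cw.
  under eq_fun do rewrite mul1r subrr mul0r addr0.
  by rewrite (fcvg w Cw).
under eq_fun do rewrite mul0r add0r subr0 mul1r.
by rewrite (fncvg w Cw); exact: cvg_cst.
Qed.

End measurable_limit.

(** * Generated sigma-algebras *)

Section generated.
Context d (T : measurableType d) (R : realType).
Variables (J : Type) (V : J -> T -> R).

Let gens : set_system T := \bigcup_i preimage_set_system [set: T] (V i) measurable.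

Definition generated_type := g_sigma_algebraType gens.

Lemma sigma_gen_setI : setI_closed (sigma_gen V).
Proof. by move=> A B; exact: (@measurableI _ generated_type). Qed.

Lemma sigma_gen_setT : sigma_gen V [set: T].
Proof. exact: (@measurableT _ generated_type). Qed.

Lemma sigma_gen_sub : (forall i, measurable_fun setT (V i)) -> sigma_gen V `<=` measurable.
Proof.
move=> mV; apply: smallest_sub; first exact: sigma_algebra_measurable.
by move=> _ [i _ [B mB <-]]; exact: mV.
Qed.

Lemma sigma_gen_preimage (f : T -> R) :
  measurable_fun setT (f : generated_type -> R) ->
  forall B : set R, measurable B -> sigma_gen V (f @^-1` B).
Proof. by move=> mf B mB; rewrite -[_ @^-1` _]setTI; exact: mf. Qed.

Lemma measurable_sigma_gen i : measurable_fun setT (V i : generated_type -> R).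
Proof. by move=> _ B mB; apply: sub_sigma_algebra; exists i => //; exists B. Qed.

End generated.

(** * Amplitudes and frequencies of the series *)

Section lepage.
Context d (T : measurableType d) (R : realType) (P : probability T R).
Variables (m : {finite_measure set (measurableTypeR R) -> \bar R}) (alpha : R).
Variables Gam G1 G2 Z : nat -> {RV P >-> R}.

Let scaled (G : {RV P >-> R}) k w := Gam k w `^ (- alpha^-1) * G w.

(** Amplitudes are functions of the products that generate [sigma_A]. *)
Lemma amplitudeE k w : amplitude m alpha Gam G1 G2 k w =
  lepage_scale m alpha * Num.sqrt (scaled (G1 k) k w ^+ 2 + scaled (G2 k) k w ^+ 2).
Proof.
rewrite /amplitude -mulrA; congr (_ * _).
rewrite /scaled !exprMn -mulrDr sqrtrM ?sqr_ge0// sqrtr_sqr ger0_norm//.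
exact: powR_ge0.
Qed.

Lemma measurable_amplitude_of dE (E : measurableType dE) (u v : E -> R) (c : R) :
  measurable_fun setT u -> measurable_fun setT v ->
  measurable_fun setT (fun w => c * Num.sqrt (u w ^+ 2 + v w ^+ 2)).
Proof.
move=> mu mv; apply: measurable_funM => //.
apply: (measurableT_comp (continuous_measurable_fun (@sqrt_continuous R))).
by apply: measurable_funD; exact: measurable_funX.
Qed.

Lemma measurable_scaled (G : {RV P >-> R}) k : measurable_fun setT (scaled G k).
Proof.
apply: measurable_funM => //.
by apply: (measurableT_comp (@measurable_powR R (- alpha^-1))).
Qed.

Lemma measurable_amplitude k : measurable_fun setT (amplitude m alpha Gam G1 G2 k).
Proof.
rewrite (_ : amplitude _ _ _ _ _ k = fun w => lepage_scale m alpha *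
  Num.sqrt (scaled (G1 k) k w ^+ 2 + scaled (G2 k) k w ^+ 2)).
  by apply: measurable_amplitude_of; exact: measurable_scaled.
by apply/funext => w; exact: amplitudeE.
Qed.

Hypothesis lepage : lepage_sequences m Gam G1 G2 Z.

Lemma independent_frequencies : independent_RVs P (fun k => Z k : T -> R).
Proof.
case: lepage => _ _ _ indep s A us sA.
(* The frequencies have the indices [inl (inr k)] in [lepage_family]. *)
pose emb (k : nat) : (nat + nat) + (nat + nat) := inl (inr k).
pose B (i : (nat + nat) + (nat + nat)) := if i is inl (inr k) then A k else set0.
have embI : injective emb by move=> i j [].
have uB : uniq (map emb s) by rewrite map_inj_uniq.
have := indep (map emb s) B uB; rewrite big_map/= => <-.
  congr (P _); apply/seteqP; split => w /= h i.
    by move=> /= /mapP[k ks ->] /=; exact: h.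
  by move=> /= si; apply: (h (emb i)); rewrite /= map_f.
by move=> i /mapP[k ks ->] /=; exact: sA.
Qed.

Lemma diffuse_frequencies (f : R -> R) :
  (forall B : set R, measurable B ->
     m B = (\int[lebesgue_measure]_(x in B) (f x)%:E)%E) ->
  forall k y, P (Z k @^-1` [set y]) = 0%E.
Proof.
case: lepage => _ _ lawZ _ mf k y.
have my : measurable [set y] by exact: measurable_set1.
rewrite -[LHS]/(distribution P (Z k) [set y]) lawZ// [X in (_ * X)%E](mf _ my).
by rewrite integral_set1 mule0.
Qed.

End lepage.

(** * Time averages and the conditional characteristic function *)

Theorem theorem3 (R : realType) (d : measure_display) (T : measurableType d)
    (P : probability T R) (alpha : R) (halpha : 0 < alpha < 2)
    (m : {finite_measure set (measurableTypeR R) -> \bar R}) (f : R -> R)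
    (f_ge0 : forall x, 0 <= f x)
    (f_meas : measurable_fun [set: R] f)
    (f_sym : forall x, f (- x) = f x)
    (m_density : forall B : set R, measurable B ->
       m B = (\int[lebesgue_measure]_(x in B) (f x)%:E)%E)
    (m_total : m [set: R] = 1%E)
    (X : R -> T -> R)
    (X_meas : measurable_fun [set: T * R] (fun p : T * R => X p.2 p.1))
    (X_SRH : stationary_SRH_SaS P m alpha X)
    (Gam G1 G2 Z Theta : nat -> {RV P >-> R})
    (lepage : lepage_sequences m Gam G1 G2 Z)
    (X_apf : apf_representation m alpha X Gam G1 G2 Z Theta)
    (lambda : R) :
  {ae P, forall w,
     cvgn (bessel_partial m alpha lambda Gam G1 G2 w) /\
     time_average (fun t => X t w) lambda A @[A --> +oo] -->
       bessel_product m alpha lambda Gam G1 G2 w} /\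
  (independent2 P (sigma_A alpha Gam G1 G2 Z)
     (sigma_gen (fun k => Theta k : T -> R)) ->
   forall t : R,
     is_cond_expectation P (sigma_A alpha Gam G1 G2 Z)
       (fun w => expi (lambda * X t w))
       (bessel_product m alpha lambda Gam G1 G2)).
Proof.
case: X_apf => lawTheta indepTheta indepAmp X_sum.
have mR k : measurable_fun setT (amplitude m alpha Gam G1 G2 k).
  exact: measurable_amplitude.
have ampF : sigma_amp_freq m alpha Gam G1 G2 Z `<=` measurable.
  by apply: sigma_gen_sub => -[k|k] //; exact: mR.
have Zfree : {ae P, forall w, rationally_independent (fun k => Z k w)}.
  apply: ae_rationally_independent; first exact: independent_frequencies lepage.
  exact: diffuse_frequencies lepage _ m_density.
have average : {ae P, forall w,
    (cvgn (fun n => complex.Re (bessel_partial m alpha lambda Gam G1 G2 w n)) /\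
     mean_value (fun t => cos (lambda * X t w))
       (limn (fun n => complex.Re (bessel_partial m alpha lambda Gam G1 G2 w n)))) /\
    (cvgn (fun n => complex.Im (bessel_partial m alpha lambda Gam G1 G2 w n)) /\
     mean_value (fun t => sin (lambda * X t w))
       (limn (fun n => complex.Im (bessel_partial m alpha lambda Gam G1 G2 w n))))}.
  apply: (@ae_time_average _ _ _ P (sigma_amp_freq m alpha Gam G1 G2 Z) Theta
    (amplitude m alpha Gam G1 G2) Z) => //.
  - exact: sigma_gen_setI.
  - exact: sigma_gen_setT.
  - move=> k; apply: sigma_gen_preimage.
    exact: (@measurable_sigma_gen _ _ _ _ _ (inl k : nat + nat)).
  - move=> k; apply: sigma_gen_preimage.
    exact: (@measurable_sigma_gen _ _ _ _ _ (inr k : nat + nat)).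
have time_averageE x A : time_average x lambda A =
    (A^-1 * (\int[lebesgue_measure]_(t in `[0%R, A]) cos (lambda * x t))%R) +i*
    (A^-1 * (\int[lebesgue_measure]_(t in `[0%R, A]) sin (lambda * x t))%R).
  by rewrite /time_average /cintegral /expi; simpc.
split.
  apply: filterS average => w [[cRe mRe] [cIm mIm]].
  pose u n := bessel_partial m alpha lambda Gam G1 G2 w n.
  have ul : u @ \oo --> ((limn (fun n => complex.Re (u n)) +i*
      limn (fun n => complex.Im (u n)) : R[i]) : R[i]^o).
    exact: (@cvg_complex _ _ _ _ u).
  split; first by apply/cvg_ex; eexists; exact: ul.
  rewrite (_ : bessel_product _ _ _ _ _ _ _ = limn (fun n => complex.Re (u n)) +i*
      limn (fun n => complex.Im (u n))); last exact: cvg_lim ul.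
  apply: (@cvg_complex _ _ _ _ (time_average (X ^~ w) lambda)).
    by under eq_fun do rewrite time_averageE; exact: mRe.
  by under eq_fun do rewrite time_averageE; exact: mIm.
move=> indepA t.
set F := sigma_A alpha Gam G1 G2 Z in indepA *.
have Fm : F `<=` measurable.
  by apply: sigma_gen_sub => -[k|[k|k]] //; exact: measurable_scaled.
pose V (i : nat + (nat + nat)) : T -> R :=
  match i with
  | inl k => Z k
  | inr (inl k) => fun w => Gam k w `^ (- alpha^-1) * G1 k w
  | inr (inr k) => fun w => Gam k w `^ (- alpha^-1) * G2 k w
  end.
pose O := generated_type V.
have mZO k : measurable_fun setT (Z k : O -> R).
  exact: (measurable_sigma_gen (V := V) (inl k)).
have mRO k : measurable_fun setT (amplitude m alpha Gam G1 G2 k : O -> R).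
  rewrite (_ : amplitude _ _ _ _ _ k = fun w => lepage_scale m alpha *
    Num.sqrt ((Gam k w `^ (- alpha^-1) * G1 k w) ^+ 2 +
              (Gam k w `^ (- alpha^-1) * G2 k w) ^+ 2)).
    apply: measurable_amplitude_of.
      exact: (measurable_sigma_gen (V := V) (inr (inl k))).
    exact: (measurable_sigma_gen (V := V) (inr (inr k))).
  by apply/funext => w; exact: amplitudeE.
pose s i w := lambda * amplitude m alpha Gam G1 G2 i w.
pose b i w := t * Z i w.
have msO k : measurable_fun setT (s k : O -> R) by exact: measurable_funM.
pose p n w := \prod_(i < n) realJ0 (s i w).
have mpO n : measurable_fun setT (p n : O -> R).
  by apply: measurable_prod => i _; exact: (measurableT_comp (@measurable_realJ0 R)).
have partialE w n : bessel_partial m alpha lambda Gam G1 G2 w n = (p n w)%:C.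
  by rewrite /p rmorph_prod; apply: eq_bigr => i _; rewrite besselJ0_real.
pose W := bessel_product m alpha lambda Gam G1 G2.
(* The value of the limit of a divergent sequence. *)
pose c : R[i] := (point : R[i]^o).
have W_cvg w : cvgn (p ^~ w) -> W w = (limn (p ^~ w))%:C.
  move=> cp; apply: cvg_lim => //.
  apply: (@cvg_complex _ _ _ _ (fun n => bessel_partial m alpha lambda Gam G1 G2 w n)).
    by under eq_fun do rewrite partialE.
  by under eq_fun do rewrite partialE; exact: cvg_cst.
have W_dvg w : ~ cvgn (p ^~ w) -> W w = c.
  move=> dp; apply: dvgP => /cvg_ex[l ul]; apply: dp; apply/cvg_ex; exists (complex.Re l).
  have pE : p ^~ w = fun n => complex.Re (bessel_partial m alpha lambda Gam G1 G2 w n).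
    by apply/funext => n; rewrite partialE.
  rewrite pE; exact: cvg_Re ul.
(* The product need not converge everywhere: where it does not, it takes the
   default value, on an event of [F]. *)
have mReO : measurable_fun setT ((fun w => complex.Re (W w)) : O -> R).
  apply: (@measurable_lim_or_cst _ (generated_type V) R p (fun w => complex.Re (W w)) (complex.Re c)) => // w.
    by move=> /W_cvg ->.
  by move=> /W_dvg ->.
have mImO : measurable_fun setT ((fun w => complex.Im (W w)) : O -> R).
  have mC : measurable ([set w | cvgn (p ^~ w)] : set O) := measurable_cvgn mpO.
  rewrite (_ : (fun w => _) = fun w => (1 - \1_([set w | cvgn (p ^~ w)]) w) * complex.Im c).
    by apply: measurable_funM => //; exact: measurable_funB.
  apply/funext => w; rewrite indicE; case: (pselect (cvgn (p ^~ w))) => h.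
    by rewrite mem_set// subrr mul0r W_cvg.
  by rewrite memNset// subr0 mul1r W_dvg.
have toT (g : T -> R) : measurable_fun setT (g : O -> R) -> measurable_fun setT g.
  by move=> mg _ B mB; apply: Fm; exact: mg.
have WB : exists2 M : R, (forall w, `|complex.Re (W w)| <= M) &
    (forall w, `|complex.Im (W w)| <= M).
  exists (1 + `|complex.Re c| + `|complex.Im c|) => w; have [h|h] := pselect (cvgn (p ^~ w)).
  - rewrite W_cvg//=; apply: le_trans (_ : 1 <= _); last by rewrite -addrA lerDl addr_ge0.
    apply: (cvgr_to_le (cvg_norm h)); apply: nearW => n; exact: prod_realJ0_le1.
  - by rewrite W_dvg// -addrA addrCA lerDl addr_ge0.
  - by rewrite W_cvg//= normr0 !addr_ge0.
  - by rewrite W_dvg// lerDr addr_ge0.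
have cvg_p : {ae P, forall w, cvgn (p ^~ w)}.
  apply: filterS average => w [[cRe _] _]; move: cRe.
  by under eq_fun do rewrite partialE.
have mXt : measurable_fun setT (X t).
  exact: (measurableT_comp X_meas (pair2_measurable t)).
have mlX : measurable_fun setT (fun w => lambda * X t w) by exact: measurable_funM.
have bmX (g : R -> R) : continuous g -> (forall u, `|g u| <= 1) ->
    P.-integrable [set: T] (fun w => (g (lambda * X t w))%:E).
  move=> cg g1; apply: (@bounded_measurable_integrable _ _ _ P _
    (fun w => g (lambda * X t w)) 1) => //.
    by rewrite ltey_eq fin_num_measure.
  exact: (measurableT_comp (continuous_measurable_fun cg) mlX).
split.
- split.
    by apply: (bmX _ (@continuous_cos R)) => u; rewrite ler_norml cos_geN1 cos_le1.
  by apply: (bmX _ (@continuous_sin R)) => u; rewrite ler_norml sin_geN1 sin_le1.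
- have [M ReM ImM] := WB; split.
    apply: (@bounded_measurable_integrable _ _ _ P _ (fun w => complex.Re (W w)) M) => //.
      by rewrite ltey_eq fin_num_measure.
    exact: toT.
  apply: (@bounded_measurable_integrable _ _ _ P _ (fun w => complex.Im (W w)) M) => //.
    by rewrite ltey_eq fin_num_measure.
  exact: toT.
- by move=> B mB; split; [exact: (sigma_gen_preimage mReO)|exact: (sigma_gen_preimage mImO)].
move=> A FA; have mA := Fm _ FA.
have [] := @Rintegral_limit _ _ _ P F Theta s b _ _ Fm indepTheta indepA lawTheta _ _ A
  (fun w => lambda * X t w) (fun w => complex.Re (W w)) FA mlX (toT _ mReO).
- exact: sigma_gen_setI.
- exact: sigma_gen_setT.
- by move=> k; exact: (sigma_gen_preimage (V := V) (msO k)).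
- move=> k; apply: (sigma_gen_preimage (V := V)); exact: measurable_funM.
- apply: filterS (X_sum t) => w Xw.
  rewrite (_ : (fun n => _) = fun n => lambda * \sum_(k < n)
    amplitude m alpha Gam G1 G2 k w * cos (Theta k w + t * Z k w)).
    by apply: cvgM => //; exact: cvg_cst.
  by apply/funext => n; rewrite mulr_sumr; apply: eq_bigr => i _; rewrite mulrA.
- by apply: filterS cvg_p => w cp; rewrite W_cvg.
move=> Ecos Esin; rewrite /cintegral /expi/= Ecos Esin; congr (_ +i* _).
(* The imaginary part of the product vanishes wherever the product converges. *)
have Im0 : Rintegral P A (fun=> 0) @[n --> \oo] --> Rintegral P A (fun w => complex.Im (W w)).
  apply: (Rintegral_dominated_cvg (f_ := fun _ _ => 0)) => //.
  - exact: toT.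
  - by move=> n w; rewrite normr0.
  - by apply: filterS cvg_p => w cp; rewrite W_cvg//; exact: cvg_cst.
have <- : limn (fun n : nat => Rintegral P A (fun=> 0)) =
    Rintegral P A (fun w => complex.Im (W w)) by exact: cvg_lim Im0.
by rewrite lim_cst// Rintegral_cst// mul0r.
Qed.
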